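(* Fix $\delta\in(0,1)$. With probability at least $1-3\delta$, the policies $\pi_1,\dots,\pi_K$ executed by the algorithm BALDE described in the context (with warm-up length $K_0=\tilde{\mathcal O}(S^2AT^4/\gamma^2)$) satisfy the budget constraint in all episodes: $$V_d(\pi_k;P)\le b_k\qquad\text{for all }k\in[K].$$
   Context: **Model.** Finite-horizon MDP with finite state space $\mathcal S$ ($S=|\mathcal S|$), finite action space $\mathcal A$ ($A=|\mathcal A|$), horizon $T$, fixed initial state $s_1$, known stage losses $l_t:\mathcal S\times\mathcal A\to[0,1]$, known resource consumptions $d_t:\mathcal S\times\mathcal A\to[0,1]$, and unknown time-dependent transition kernels $P=(P_t)_{t=1}^T$, $P_t(\cdot\mid s,a)\in\Delta(\mathcal S)$. A policy $\pi=(\pi_t)_{t=1}^T$ has $\pi_t:\mathcal S\to\Delta(\mathcal A)$. For stage functions $r=(r_t)$ and a model $P'$, $V_r(\pi;P')=\mathbb E_{\pi,P'}[\sum_{t=1}^T r_t(s_t,a_t)]$. **Budgets.** The interaction lasts $K$ episodes. The budget $b_k\in\mathcal B=[B_0,T]$ of episode $k$ is fixed before the episode (possibly depending on past observations), and $b_k=B_0$ for $k\le K_0$. **Baseline.** A policy $\pi_{\rm base}$ with $V_d(\pi_{\rm base};P)=b_{\rm base}<B_0$ is given, with $b_{\rm base}$ known; $\gamma=B_0-b_{\rm base}>0$. **BALDE (episode $k$, budget $b_k$).** Let $n_{k,t}(s,a)$ and $n_{k,t}(s,a,s')$ be the numbers of episodes $k'<k$ with $(s_{k',t},a_{k',t})=(s,a)$,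 respectively $(s_{k',t},a_{k',t},s_{k',t+1})=(s,a,s')$. Put $\hat P_{k,t}(s'|s,a)=n_{k,t}(s,a,s')/(n_{k,t}(s,a)\vee1)$, $L'=\log(2SATK/\delta)$, $$\beta^p_{k,t}(s,a,s')=\sqrt{\frac{4\hat P_{k,t}(s'|s,a)(1-\hat P_{k,t}(s'|s,a))L'}{n_{k,t}(s,a)\vee1}}+\frac{14L'/3}{n_{k,t}(s,a)\vee1},$$ $\beta^p_{k,t}(s,a)=\sum_{s'}\beta^p_{k,t}(s,a,s')$, and let $\mathcal P_k$ be the set of transition kernels $P'$ with $|P'_t(s'|s,a)-\hat P_{k,t}(s'|s,a)|\le\beta^p_{k,t}(s,a,s')$ for all $t,s,a,s'$. Put $\bar d_{k,t}(s,a)=d_t(s,a)+T\beta^p_{k,t}(s,a)$ and $\bar l_{k,t}(s,a)=l_t(s,a)-\frac{T^2\beta^p_{k,t}(s,a)}{b_k-b_{\rm base}}$. If $k\le K_0$, execute $\pi_k=\pi_{\rm base}$. If $k>K_0$, let $(\pi_k,P_k)$ be a solution of $$\min_{\pi,\,P'\in\mathcal P_k}V_{\bar l_k}(\pi;P')\quad\text{s.t. } V_{\bar d_k}(\pi;P')\le b_k,$$ and execute $\pi_k$ in the true MDP, recording the observed trajectory. **Convention.** $K_0=\tilde{\mathcal O}(S^2AT^4/\gamma^2)$ is chosen with a sufficiently large hidden factor, polylogarithmic in $S,A,T,K,1/\delta$. *)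

(* Defs.v *)
(* MathComp / MathComp-Analysis. *)
From mathcomp Require Import all_boot all_order all_algebra.
From mathcomp Require Import all_classical all_reals all_analysis.
Import Order.TTheory GRing.Theory Num.Theory.
Import numFieldNormedType.Exports.

Set Implicit Arguments.
Unset Strict Implicit.
Unset Printing Implicit Defensive.

Local Open Scope classical_set_scope.
Local Open Scope ring_scope.

Section MDP.
Context {R : realType} {S A : finType} {T : nat}.

(* The stage t ranges over 'I_T, so that it is 0-based: stage t : 'I_T stands
   for stage t + 1 of the 1-based convention. *)
Definition policy := 'I_T -> S -> A -> R.
Definition transition_kernel := 'I_T -> S -> A -> S -> R.
Definition stagefun := 'I_T -> S -> A -> R.

Definition is_policy (pi : policy) : Prop :=
  forall t s, (forall a, 0 <= pi t s a) /\ \sum_a pi t s a = 1.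

Definition is_kernel (P : transition_kernel) : Prop :=
  forall t s a, (forall s', 0 <= P t s a s') /\ \sum_s' P t s a s' = 1.

Definition unit_valued (r : stagefun) : Prop := forall t s a, 0 <= r t s a <= 1.

(* T + 1 states and T actions: the kernel of the last stage also produces an
   (observed) state, which enters the transition counts of that stage. *)
Definition trajectory : finType :=
  ({ffun 'I_T.+1 -> S} * {ffun 'I_T -> A})%type.

Definition state (x : trajectory) (t : 'I_T) : S := x.1 (widen_ord (leqnSn T) t).
Definition action (x : trajectory) (t : 'I_T) : A := x.2 t.
Definition next_state (x : trajectory) (t : 'I_T) : S := x.1 (lift ord0 t).

Definition traj_prob (s1 : S) (pi : policy) (P : transition_kernel) (x : trajectory) : R :=
  (x.1 ord0 == s1)%:R *
  \prod_(t < T) (pi t (state x t) (action x t) *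
                 P t (state x t) (action x t) (next_state x t)).

Definition value (s1 : S) (r : stagefun) (pi : policy) (P : transition_kernel) : R :=
  \sum_(x : trajectory)
    traj_prob s1 pi P x * \sum_(t < T) r t (state x t) (action x t).

End MDP.

Arguments policy : clear implicits.
Arguments transition_kernel : clear implicits.
Arguments stagefun : clear implicits.
Arguments trajectory : clear implicits.

Section BALDE.
Context {R : realType} {S A : finType} {T : nat}.
Variables (K : nat) (delta : R) (s1 : S) (l d : stagefun R S A T) (b_base : R).

(* The factor L'. *)
Definition logfactor : R := ln (2 * #|S|%:R * #|A|%:R * T%:R * K%:R / delta).

(* X j is the trajectory of episode j; episodes are numbered from 1. *)
Variables (X : nat -> trajectory S A T) (k : nat).

Definition visits (t : 'I_T) (s : S) (a : A) : nat :=
  (\sum_(1 <= j < k) ((state (X j) t == s) && (action (X j) t == a)))%N.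

Definition transitions (t : 'I_T) (s : S) (a : A) (s' : S) : nat :=
  (\sum_(1 <= j < k) [&& state (X j) t == s, action (X j) t == a
                       & next_state (X j) t == s'])%N.

Definition visits1 (t : 'I_T) (s : S) (a : A) : R := (maxn (visits t s a) 1)%:R.

Definition P_hat (t : 'I_T) (s : S) (a : A) (s' : S) : R :=
  (transitions t s a s')%:R / visits1 t s a.

Definition beta3 (t : 'I_T) (s : S) (a : A) (s' : S) : R :=
  Num.sqrt (4 * P_hat t s a s' * (1 - P_hat t s a s') * logfactor
              / visits1 t s a)
  + (14 * logfactor / 3) / visits1 t s a.

Definition beta (t : 'I_T) (s : S) (a : A) : R := \sum_s' beta3 t s a s'.

Definition confidence_set : set (transition_kernel R S A T) :=
  [set P' | is_kernel P' /\
            forall t s a s', `|P' t s a s' - P_hat t s a s'| <= beta3 t s a s'].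

Definition d_bar : stagefun R S A T :=
  fun t s a => d t s a + T%:R * beta t s a.

(* b is the budget of episode k. *)
Variable b : R.

Definition l_bar : stagefun R S A T :=
  fun t s a => l t s a - T%:R ^+ 2 * beta t s a / (b - b_base).

Definition feasible (pi : policy R S A T) (P' : transition_kernel R S A T) : Prop :=
  [/\ is_policy pi, confidence_set P' & value s1 d_bar pi P' <= b].

Definition balde_solution (pi : policy R S A T) (P' : transition_kernel R S A T) : Prop :=
  feasible pi P' /\
  forall pi2 P2, feasible pi2 P2 ->
    value s1 l_bar pi P' <= value s1 l_bar pi2 P2.

End BALDE.

(* The policy of episode k.  The optimization problem depends on the observed
   data and may be infeasible, in which case it has no solution and nothing is
   prescribed (beyond playing some policy). *)
Definition balde_policy {R : realType} {S A : finType} {T : nat}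
    (K : nat) (delta : R) (s1 : S) (l d : stagefun R S A T) (b_base : R)
    (pi_base : policy R S A T) (K0 : nat)
    (X : nat -> trajectory S A T) (k : nat) (b : R)
    (pi : policy R S A T) : Prop :=
  [/\ is_policy pi,
      (k <= K0)%N -> pi = pi_base
    & (K0 < k)%N ->
      (exists pi' P', balde_solution K delta s1 l d b_base X k b pi' P') ->
      exists P', balde_solution K delta s1 l d b_base X k b pi P'].

Section Interaction.
Context {R : realType} {disp : measure_display} {Omega : measurableType disp}.

Definition filtration (F : nat -> set_system Omega) : Prop :=
  [/\ forall k, sigma_algebra [set: Omega] (F k),
      forall k, F k `<=` measurable
    & forall j k, (j <= k)%N -> F j `<=` F k].

Definition measurable_wrt (G : set_system Omega) (f : Omega -> R) : Prop :=
  preimage_set_system [set: Omega] f measurable `<=` G.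

(* F k is the information available just before episode k.  It contains the
   trajectories of the earlier episodes and possibly extra information, such as
   the randomness used to choose budgets or to break ties.  The last clause says
   that, conditionally on F k, the trajectory of episode k is distributed as a
   trajectory of the MDP with kernel P under the policy pi k. *)
Definition interaction {S A : finType} {T : nat} (Pr : probability Omega R)
    (K : nat) (s1 : S) (P : transition_kernel R S A T)
    (F : nat -> set_system Omega) (X : nat -> Omega -> trajectory S A T)
    (b : nat -> Omega -> R) (pi : nat -> Omega -> policy R S A T) : Prop :=
  filtration F /\
  forall k, (0 < k <= K)%N ->
    [/\ measurable_wrt (F k) (b k),
        forall t s a, measurable_wrt (F k) (fun w => pi k w t s a),
        forall x, F k.+1 [set w | X k w = x]
      & forall x E, F k E ->
          Pr (E `&` [set w | X k w = x]) =
          (\int[Pr]_(w in E) (traj_prob s1 (pi k w) P x)%:E)%E].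

End Interaction.

(* Main.v *)
Require Import Defs.
From mathcomp Require Import all_boot all_order all_algebra.
From mathcomp Require Import all_classical all_reals all_analysis.
From mathcomp Require Import measurable_realfun ring lra zify.
Import Order.TTheory GRing.Theory Num.Theory.
Import numFieldNormedType.Exports.
Local Open Scope classical_set_scope.
Local Open Scope ring_scope.

Set Implicit Arguments.
Unset Strict Implicit.
Unset Printing Implicit Defensive.

(* Warm-up: under the known baseline each triple (t, s, a) of occupancy q is visited
   at least K0 q / 2 - L times, where L is the logarithmic factor, so the total
   confidence width seen by the baseline is at most the slack B0 - b_base; hence
   (pi_base, P) is feasible whenever P lies in the confidence set, and by compactness
   an optimal pair (pi_k, P_k) exists.  Since both P and P_k lie within beta of the
   empirical kernel, the bonus T * beta in d_bar dominates the simulation error, and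
   V_d(pi_k; P) <= V_dbar(pi_k; P_k) <= b_k.

   That P lies in all confidence sets is an empirical Bernstein bound.  A union bound
   at level exp (- L) over (t, s, a, s', n) would lose a factor |S|.  The constants 4
   and 14 / 3 leave room for the level exp (- 4 / 3 L), and exp (L / 3) >= |S| because
   K0 <= K forces K >= |S| ^ 2. *)

(** * Trajectories and values *)

(** The denominator of [P_hat] is a random visit count, whereas a Chernoff tilt must be fixed before
    the data are seen. Each possible count n therefore gets its own tilt, computed from the true
    probability and n alone, and its own exponential process, stopped after n visits. The union over
    n costs the factor K, which [logfactor] contains. These processes and those of the warm-up
    counts add up to one nonnegative supermartingale that is at least 1 on every failure, so its
    initial value serves as Markov and union bound at once. In the cost of the baseline, the square
    root of the width is split so that one part keeps the factor [P_hat]. Weighted by the occupancy,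
    this part sums to a constant per stage; only the part divided by K0 is multiplied by |S|^2 |A|.
    Existence of a minimiser has to be proved because [balde_policy] constrains later policies only
    when a solution exists. *)

Definition traj_cons {S A : finType} {T : nat} (s : S) (a : A)
    (y : trajectory S A T) : trajectory S A T.+1 :=
  ([ffun i : 'I_T.+2 => oapp y.1 s (unlift ord0 i)],
   [ffun i : 'I_T.+1 => oapp y.2 a (unlift ord0 i)]).

Definition traj_behead {S A : finType} {T : nat} (x : trajectory S A T.+1) :
    trajectory S A T :=
  ([ffun i => x.1 (lift ord0 i)], [ffun i => x.2 (lift ord0 i)]).

Lemma traj_consK (S A : finType) (T : nat) (x : trajectory S A T.+1) :
  traj_cons (x.1 ord0) (x.2 ord0) (traj_behead x) = x.
Proof.
case: x => u v; congr pair; apply/ffunP => i; rewrite ffunE;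
  by case: unliftP => [j ->|->] //=; rewrite ffunE.
Qed.

Lemma traj_cons_state0 (S A : finType) (T : nat) (s : S) (a : A)
  (y : trajectory S A T) : (traj_cons s a y).1 ord0 = s.
Proof. by rewrite ffunE unlift_none. Qed.

Lemma state_cons0 (S A : finType) (T : nat) (s : S) (a : A)
  (y : trajectory S A T) : state (traj_cons s a y) ord0 = s.
Proof.
rewrite /state; have -> : widen_ord (leqnSn T.+1) ord0 = ord0 by apply: val_inj.
exact: traj_cons_state0.
Qed.

Lemma action_cons0 (S A : finType) (T : nat) (s : S) (a : A)
  (y : trajectory S A T) : action (traj_cons s a y) ord0 = a.
Proof. by rewrite /action ffunE unlift_none. Qed.

Lemma next_state_cons0 (S A : finType) (T : nat) (s : S) (a : A)
  (y : trajectory S A T) : next_state (traj_cons s a y) ord0 = y.1 ord0.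
Proof. by rewrite /next_state ffunE liftK. Qed.

Lemma state_consS (S A : finType) (T : nat) (s : S) (a : A)
  (y : trajectory S A T) (t : 'I_T) :
  state (traj_cons s a y) (lift ord0 t) = state y t.
Proof.
rewrite /state.
have -> : widen_ord (leqnSn T.+1) (lift ord0 t) =
          lift ord0 (widen_ord (leqnSn T) t) by apply: val_inj.
by rewrite ffunE liftK.
Qed.

Lemma action_consS (S A : finType) (T : nat) (s : S) (a : A)
  (y : trajectory S A T) (t : 'I_T) :
  action (traj_cons s a y) (lift ord0 t) = action y t.
Proof. by rewrite /action ffunE liftK. Qed.

Lemma next_state_consS (S A : finType) (T : nat) (s : S) (a : A)
  (y : trajectory S A T) (t : 'I_T) :
  next_state (traj_cons s a y) (lift ord0 t) = next_state y t.
Proof. by rewrite /next_state ffunE liftK. Qed.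

Lemma sum_traj_cons (R : nmodType) (S A : finType) (T : nat)
  (F : trajectory S A T.+1 -> R) :
  \sum_x F x = \sum_s \sum_a \sum_y F (traj_cons s a y).
Proof.
rewrite pair_big pair_big /=.
rewrite (reindex (fun p : S * A * trajectory S A T => traj_cons p.1.1 p.1.2 p.2)) //=.
exists (fun x : trajectory S A T.+1 => (x.1 ord0, x.2 ord0, traj_behead x)) => [[[s a] y] _|x _] /=.
  rewrite !ffunE !unlift_none /=; congr pair.
  by case: y => u v; congr pair; apply/ffunP => i; rewrite !ffunE liftK.
exact: traj_consK.
Qed.

Definition expect {R : realType} {S A : finType} {T : nat} (s1 : S)
    (pi : policy R S A T) (P : transition_kernel R S A T)
    (f : trajectory S A T -> R) : R :=
  \sum_x traj_prob s1 pi P x * f x.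

Definition tail {X : Type} {T : nat} (r : 'I_T.+1 -> X) : 'I_T -> X :=
  fun t => r (lift ord0 t).

(** [traj_prob] vanishes unless the trajectory starts in the prescribed state. This kills every
    first state but [s1] and, for the tail, every [s'] but the tail's own first state. *)
Lemma expect_cons (R : realType) (S A : finType) (T : nat) (s1 : S)
  (pi : policy R S A T.+1) (P : transition_kernel R S A T.+1)
  (f : trajectory S A T.+1 -> R) :
  expect s1 pi P f =
  \sum_a pi ord0 s1 a * \sum_s' P ord0 s1 a s' *
     expect s' (tail pi) (tail P) (fun y => f (traj_cons s1 a y)).
Proof.
rewrite /expect sum_traj_cons (bigD1 s1) //= [X in _ + X]big1 ?addr0; last first.
  move=> s ns; apply: big1 => a _; apply: big1 => y _.
  by rewrite /traj_prob traj_cons_state0 (negbTE ns) !mul0r.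
apply: eq_bigr => a _; rewrite mulr_sumr.
under [RHS]eq_bigr do rewrite !mulr_sumr.
rewrite exchange_big /=; apply: eq_bigr => y _.
rewrite (bigD1 (y.1 ord0)) //= [X in _ + X]big1 ?addr0; last first.
  move=> s ns; rewrite /traj_prob eq_sym (negbTE ns).
  by rewrite !mul0r !mulr0.
rewrite /traj_prob traj_cons_state0 !eqxx !mul1r big_ord_recl.
rewrite state_cons0 action_cons0 next_state_cons0 !mulrA; congr (_ * _ * _).
by apply: eq_bigr => t _; rewrite state_consS action_consS next_state_consS.
Qed.

Lemma expect_T0 (R : realType) (S A : finType) (s1 : S)
  (pi : policy R S A 0) (P : transition_kernel R S A 0) (c : R) :
  expect s1 pi P (fun=> c) = c.
Proof.
rewrite /expect.
pose x0 : trajectory S A 0 :=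
  ([ffun=> s1], ffun0 (card_ord 0)).
rewrite (bigD1 x0) //= [X in _ + X]big1 ?addr0.
  by rewrite /traj_prob big_ord0 /= ffunE eqxx !mul1r.
move=> x nx; rewrite /traj_prob; case: eqP => [e|_]; last by rewrite !mul0r.
case/eqP: nx; case: x e => u v /= e; congr pair; apply/ffunP.
  by move=> i; rewrite ffunE -e; congr (u _); apply: val_inj; case: i => -[].
by case.
Qed.

Lemma expectD (R : realType) (S A : finType) (T : nat) (s1 : S)
  (pi : policy R S A T) (P : transition_kernel R S A T)
  (f g : trajectory S A T -> R) :
  expect s1 pi P (fun x => f x + g x) = expect s1 pi P f + expect s1 pi P g.
Proof. by rewrite /expect -big_split /=; apply: eq_bigr => x _; rewrite mulrDr. Qed.

Lemma expectZ (R : realType) (S A : finType) (T : nat) (s1 : S)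
  (pi : policy R S A T) (P : transition_kernel R S A T)
  (c : R) (f : trajectory S A T -> R) :
  expect s1 pi P (fun x => c * f x) = c * expect s1 pi P f.
Proof. by rewrite /expect mulr_sumr; apply: eq_bigr => x _; rewrite mulrCA. Qed.

Lemma expect_sum (R : realType) (S A I : finType) (T : nat) (s1 : S)
  (pi : policy R S A T) (P : transition_kernel R S A T)
  (f : I -> trajectory S A T -> R) :
  expect s1 pi P (fun x => \sum_i f i x) = \sum_i expect s1 pi P (f i).
Proof.
rewrite /expect exchange_big /=; apply: eq_bigr => x _; by rewrite mulr_sumr.
Qed.

Lemma is_policy_tail (R : realType) (S A : finType) (T : nat)
  (pi : policy R S A T.+1) : is_policy pi -> is_policy (tail pi).
Proof. by move=> h t s; exact: h. Qed.

Lemma is_kernel_tail (R : realType) (S A : finType) (T : nat)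
  (P : transition_kernel R S A T.+1) : is_kernel P -> is_kernel (tail P).
Proof. by move=> h t s a; exact: h. Qed.

Lemma traj_prob_ge0 (R : realType) (S A : finType) (T : nat) (s1 : S)
  (pi : policy R S A T) (P : transition_kernel R S A T)
  (x : trajectory S A T) :
  is_policy pi -> is_kernel P -> 0 <= traj_prob s1 pi P x.
Proof.
move=> hpi hP; apply: mulr_ge0; first exact: ler0n.
apply: prodr_ge0 => t _; apply: mulr_ge0; first by have [] := hpi t (state x t).
by have [] := hP t (state x t) (action x t).
Qed.

Lemma expect_cst (R : realType) (S A : finType) (T : nat) (s1 : S)
  (pi : policy R S A T) (P : transition_kernel R S A T) (c : R) :
  is_policy pi -> is_kernel P -> expect s1 pi P (fun=> c) = c.
Proof.
elim: T s1 pi P => [|T IH] s1 pi P hpi hP; first exact: expect_T0.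
rewrite expect_cons -[RHS]mul1r -(hpi ord0 s1).2 mulr_suml.
apply: eq_bigr => a _; congr (_ * _).
rewrite -[RHS]mul1r -(hP ord0 s1 a).2 mulr_suml; apply: eq_bigr => s' _.
by rewrite IH//; [exact: is_policy_tail|exact: is_kernel_tail].
Qed.

Lemma ler_expect (R : realType) (S A : finType) (T : nat) (s1 : S)
  (pi : policy R S A T) (P : transition_kernel R S A T)
  (f g : trajectory S A T -> R) :
  is_policy pi -> is_kernel P -> (forall x, f x <= g x) ->
  expect s1 pi P f <= expect s1 pi P g.
Proof.
move=> hpi hP fg; apply: ler_sum => x _.
by apply: ler_wpM2l => //; exact: traj_prob_ge0.
Qed.

Lemma valueE (R : realType) (S A : finType) (T : nat) (s1 : S)
  (r : stagefun R S A T) (pi : policy R S A T) (P : transition_kernel R S A T) :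
  value s1 r pi P =
  expect s1 pi P (fun x => \sum_(t < T) r t (state x t) (action x t)).
Proof. by []. Qed.

Lemma value_T0 (R : realType) (S A : finType) (s1 : S)
  (r : stagefun R S A 0) (pi : policy R S A 0) (P : transition_kernel R S A 0) :
  value s1 r pi P = 0.
Proof. by rewrite /value big1 // => x _; rewrite big_ord0 mulr0. Qed.

Lemma value_bellman (R : realType) (S A : finType) (T : nat) (s1 : S)
  (r : stagefun R S A T.+1) (pi : policy R S A T.+1)
  (P : transition_kernel R S A T.+1) :
  is_policy pi -> is_kernel P ->
  value s1 r pi P = \sum_a pi ord0 s1 a *
    (r ord0 s1 a + \sum_s' P ord0 s1 a s' * value s' (tail r) (tail pi) (tail P)).
Proof.
move=> hpi hP; rewrite valueE expect_cons; apply: eq_bigr => a _; congr (_ * _).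
rewrite -[r ord0 s1 a]mul1r -(hP ord0 s1 a).2 mulr_suml -big_split /=.
apply: eq_bigr => s' _; rewrite -mulrDr; congr (_ * _).
rewrite valueE -(expect_cst s' (r ord0 s1 a) (is_policy_tail hpi) (is_kernel_tail hP)) -expectD.
apply: eq_bigr => y _; congr (_ * _).
rewrite big_ord_recl state_cons0 action_cons0; congr (_ + _).
by apply: eq_bigr => t _; rewrite state_consS action_consS.
Qed.

Lemma value_bounds (R : realType) (S A : finType) (T : nat) (s1 : S)
  (r : stagefun R S A T) (pi : policy R S A T) (P : transition_kernel R S A T) :
  is_policy pi -> is_kernel P -> unit_valued r -> 0 <= value s1 r pi P <= T%:R.
Proof.
move=> hpi hP hr; rewrite valueE; apply/andP; split.
  rewrite -[leLHS](expect_cst s1 _ hpi hP); apply: ler_expect => // x.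
  by apply: sumr_ge0 => t _; have /andP[] := hr t (state x t) (action x t).
rewrite -[leRHS](expect_cst s1 _ hpi hP); apply: ler_expect => // x.
apply: (@le_trans _ _ (\sum_(t < T) 1)); last by rewrite sumr_const card_ord.
by apply: ler_sum => t _; have /andP[] := hr t (state x t) (action x t).
Qed.

(* The values lie in [0, T - 1], so subtracting their midpoint makes them at most
   M / 2 in absolute value; this compensates the factor 2 in the distance of the
   kernels. *)
Lemma value_simulation (R : realType) (S A : finType) (T : nat) (s1 : S) (M : R)
  (d : stagefun R S A T) (B : 'I_T -> S -> A -> R) (pi : policy R S A T)
  (P P' : transition_kernel R S A T) :
  T%:R <= M -> is_policy pi -> is_kernel P -> is_kernel P' -> unit_valued d ->
  (forall t s a, \sum_s' `|P t s a s' - P' t s a s'| <= 2 * B t s a) ->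
  value s1 d pi P <= value s1 (fun t s a => d t s a + M * B t s a) pi P'.
Proof.
(* [M] stays fixed in the induction: the remaining horizon shrinks, but the bonus keeps its
   factor. *)
elim: T s1 d B pi P P' => [|T IH] s1 d B pi P P' TM hpi hP hP' hd hB.
  by rewrite !value_T0.
rewrite !value_bellman //; apply: ler_sum => a _; apply: ler_wpM2l.
  by have [] := hpi ord0 s1.
rewrite -addrA lerD2l.
have M0 : 0 <= M by apply: le_trans TM.
have TM' : T%:R <= M by apply: le_trans TM; rewrite ler_nat.
set v := fun s' => value s' (tail d) (tail pi) (tail P).
pose v' s' :=
  value s' (tail (fun t s a => d t s a + M * B t s a)) (tail pi) (tail P').
have vv' s' : v s' <= v' s'.
  apply: (IH s' (tail d) (tail B)) => //; [exact: is_policy_tail|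
    exact: is_kernel_tail|exact: is_kernel_tail|by move=> *; exact: hd|].
  by move=> *; exact: hB.
have vb s' : `|v s' - M / 2| <= M / 2.
  have /andP[v0 vT] : 0 <= v s' <= T%:R.
    apply: value_bounds; [exact: is_policy_tail|exact: is_kernel_tail|].
    by move=> *; exact: hd.
  by rewrite ler_norml; lra.
rewrite -/v'.
apply: (@le_trans _ _ (M * B ord0 s1 a + \sum_s' P' ord0 s1 a s' * v s')); last first.
  rewrite lerD2l; apply: ler_sum => s' _; apply: ler_wpM2l => //.
  by have [] := hP' ord0 s1 a.
rewrite -lerBlDr -sumrB.
(* Both rows sum to 1, so centring the values at [M / 2] does not change the sum. *)
rewrite (eq_bigr (fun s' => (P ord0 s1 a s' - P' ord0 s1 a s') * (v s' - M / 2)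
    + (P ord0 s1 a s' - P' ord0 s1 a s') * (M / 2))); last first.
  by move=> s' _; rewrite -mulrDr subrK mulrBl.
rewrite big_split /= -mulr_suml sumrB (hP ord0 s1 a).2 (hP' ord0 s1 a).2.
rewrite subrr mul0r addr0.
apply: (@le_trans _ _ (\sum_s' `|P ord0 s1 a s' - P' ord0 s1 a s'| * (M / 2))).
  apply: ler_sum => s' _; apply: le_trans (ler_norm _) _.
  by rewrite normrM; apply: ler_wpM2l.
rewrite -mulr_suml; apply: (@le_trans _ _ (2 * B ord0 s1 a * (M / 2))).
  by apply: ler_wpM2r => //; rewrite divr_ge0.
by rewrite [leLHS](_ : _ = M * B ord0 s1 a) //; field.
Qed.

(** Tower property at stage [t]: the one-step mean is bounded for every state and action, hence
    whatever the law of the past, and the later stages integrate to 1. *)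
Lemma expect_transition_le1 (R : realType) (S A : finType) (T : nat) (s1 : S)
  (pi : policy R S A T) (P : transition_kernel R S A T) (t : 'I_T)
  (g : S -> A -> S -> R) :
  is_policy pi -> is_kernel P ->
  (forall s a, \sum_s' P t s a s' * g s a s' <= 1) ->
  expect s1 pi P (fun x => g (state x t) (action x t) (next_state x t)) <= 1.
Proof.
elim: T s1 pi P t => [|T IH] s1 pi P t hpi hP hg; first by case: t hg.
rewrite expect_cons -[leRHS](hpi ord0 s1).2; apply: ler_sum => a _.
rewrite -[leRHS]mulr1; apply: ler_wpM2l; first by have [] := hpi ord0 s1.
have [hpi' hP'] := (is_policy_tail hpi, is_kernel_tail hP).
case: (unliftP ord0 t) hg => [j ->|->] hg.
  rewrite -[leRHS](hP ord0 s1 a).2; apply: ler_sum => s' _.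
  rewrite -[leRHS]mulr1; apply: ler_wpM2l; first by have [] := hP ord0 s1 a.
  apply: le_trans (IH s' _ _ j hpi' hP' hg).
  by apply: ler_expect => // x; rewrite state_consS action_consS next_state_consS.
apply: le_trans (hg s1 a); apply: ler_sum => s' _.
apply: ler_wpM2l; first by have [] := hP ord0 s1 a.
rewrite -[leRHS](expect_cst s' _ hpi' hP'); apply: ler_sum => y _.
rewrite state_cons0 action_cons0 next_state_cons0 /traj_prob.
by case: eqP => [->//|_]; rewrite !mul0r.
Qed.

(** * Supermartingales along the interaction *)

Lemma sigma_algebra_setI (X : Type) (G : set_system X) (A B : set X) :
  sigma_algebra [set: X] G -> G A -> G B -> G (A `&` B).
Proof.
move=> [_ GC GU] GA GB.
(* De Morgan, with the two complements padded to a sequence because the axioms speak of countable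
   unions. *)
pose C n := if n == 0%N then [set: X] `\` A else [set: X] `\` B.
have /GC : G (\bigcup_n C n) by apply: GU => -[|n]; exact: GC.
rewrite (_ : _ `\` _ = A `&` B) //.
apply/seteqP; split=> w /=.
  move=> [_ h]; split; apply: contrapT => nw; apply: h.
    by exists 0%N.
  by exists 1%N.
by move=> [Aw Bw]; split => // -[[|n] _ /=] [].
Qed.

(** Measurability and the union bound come together because the event to be covered is known to be
    measurable only through its pieces. *)
Lemma measure_fin_cover (R : realType) (disp : measure_display)
  (Omega : measurableType disp) (mu : {measure set Omega -> \bar R})
  (I : finType) (A : set Omega) (A_ : I -> set Omega) :
  (forall i, measurable (A_ i)) -> (forall w, A w <-> exists i, A_ i w) ->
  measurable A /\ (mu A <= \sum_i mu (A_ i))%E.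
Proof.
move=> mA hA.
have -> : A = \big[setU/set0]_(i <- index_enum I) A_ i.
  rewrite -bigcup_seq; apply/seteqP; split=> w.
    by move=> /hA[i Ai]; exists i => //=; exact: mem_index_enum.
  by move=> [i _ Ai]; apply/hA; exists i.
elim: (index_enum I) => [|i s [ms les]].
  by rewrite !big_nil measure0; split.
rewrite !big_cons; split; first exact: measurableU.
by apply: le_trans (measureU2 _ _ _) _ => //; exact: leeD.
Qed.

Definition update {X : Type} (y : nat -> X) (k : nat) (x : X) : nat -> X :=
  fun j => if j == k then x else y j.

Lemma measurable_traj_prob (R : realType) (disp : measure_display)
  (Omega : measurableType disp) (S A : finType) (T : nat) (D : set Omega)
  (s1 : S) (pi : Omega -> policy R S A T) (P : transition_kernel R S A T)
  (x : trajectory S A T) :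
  (forall t s a, measurable_fun D (fun w => pi w t s a)) ->
  measurable_fun D (fun w => traj_prob s1 (pi w) P x).
Proof.
move=> hpi; apply: measurable_funM => //; apply: measurable_prod => t _.
exact: measurable_funM.
Qed.

(* The trajectory space is finite, so a backward induction over the episodes,
   conditioning on the observed history, replaces conditional expectations. *)
Lemma interaction_supermartingale (R : realType) (disp : measure_display)
  (Omega : measurableType disp) (S A : finType) (T K : nat)
  (Pr : probability Omega R) (s1 : S) (P : transition_kernel R S A T)
  (F : nat -> set_system Omega) (X : nat -> Omega -> trajectory S A T)
  (b : nat -> Omega -> R) (pi : nat -> Omega -> policy R S A T)
  (B : set (nat -> trajectory S A T))
  (W : nat -> (nat -> trajectory S A T) -> R) (y0 : nat -> trajectory S A T) :
  interaction Pr K s1 P F X b pi -> is_kernel P ->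
  (forall k w, (0 < k <= K)%N -> is_policy (pi k w)) ->
  (forall k y, 0 <= W k y) ->
  (forall k y w, (0 < k <= K)%N ->
     expect s1 (pi k w) P (fun x => W k.+1 (update y k x)) <= W k y) ->
  (forall y y', (forall j, (0 < j <= K)%N -> y j = y' j) -> B y -> B y') ->
  (forall y, B y -> 1 <= W K.+1 y) ->
  measurable [set w | B (X ^~ w)] /\
  (Pr [set w | B (X ^~ w)] <= (W 1%N y0)%:E)%E.
Proof.
move=> [[Fs Fm Fh] hint] hP hpi W0 hW Bext BW.
set BX := [set w | B (X ^~ w)].
(* Restricting to an event [E] on which the trajectories before episode [k] are those of [y] makes
   [W k y] a number rather than a random variable. *)
suff H m k E y : (k + m = K.+1)%N -> (0 < k)%N -> F k E ->
    (forall w j, E w -> (0 < j < k)%N -> X j w = y j) ->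
    measurable (E `&` BX) /\ (Pr (E `&` BX) <= (W k y)%:E * Pr E)%E.
  have FT : F 1%N [set: Omega].
    by have [F0 FC _] := Fs 1%N; have := FC _ F0; rewrite setD0.
  have [] := H K 1%N [set: Omega] y0 (add1n K) isT FT.
    by move=> w [|[|j]].
  by rewrite setTI probability_setT mule1.
elim: m k E y => [|m IH] k E y km k0 FE hE.
  have kE : k = K.+1 by lia.
  rewrite kE in hE *.
  have mE : measurable E by exact: Fm FE.
  (* [B] depends on episodes 1 to K only, so it holds everywhere on [E] or nowhere. *)
  have [By|nBy] := pselect (B y).
    have -> : E `&` BX = E.
      apply/setIidPl => w Ew; apply: (Bext y) => // j jK.
      by rewrite (hE w) //; lia.
    split=> //; rewrite -[leLHS]mul1e; apply: lee_wpmul2r => //.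
    by rewrite lee_fin; exact: BW.
  have -> : E `&` BX = set0.
    apply/seteqP; split => // w [Ew Bw]; apply: nBy; apply: Bext Bw => j jK.
    by rewrite (hE w) //; lia.
  by rewrite measure0; split=> //; apply: mule_ge0 => //; rewrite lee_fin.
have kK : (0 < k <= K)%N by lia.
have [_ mpi FX PrX] := hint k kK.
have mE : measurable E by exact: Fm FE.
have mpiE t s a : measurable_fun E (fun w => pi k w t s a).
  apply: (@measurable_funS _ _ _ _ [set: Omega]) => //.
  by move=> _ Y mY; apply: (Fm k); apply: mpi; exists Y.
pose Ex x := E `&` [set w | X k w = x].
have FEx x : F k.+1 (Ex x).
  by apply: (sigma_algebra_setI (Fs k.+1)) => //; apply: Fh FE.
have hx x : measurable (Ex x `&` BX) /\
    (Pr (Ex x `&` BX) <= (W k.+1 (update y k x))%:E * Pr (Ex x))%E.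
  apply: IH => //; first lia.
  move=> w j [Ew Xw] jk; rewrite /update; case: eqP => [->//|jnk].
  by apply: hE => //; lia.
have [mEB PrEB] := @measure_fin_cover R disp Omega Pr _ (E `&` BX)
    (fun x => Ex x `&` BX) (fun x => (hx x).1) (fun w => conj
      (fun '(conj Ew Bw) => ex_intro _ (X k w) (conj (conj Ew erefl) Bw))
      (fun '(ex_intro x (conj (conj Ew _) Bw)) => conj Ew Bw)).
split=> //; apply: le_trans PrEB _.
(* The probability of each piece is an integral of [traj_prob] over [E]. Summed under the integral
   sign, the pieces give the conditional mean of [W k.+1], which [hW] bounds by [W k y]. *)
apply: (@le_trans _ _ (\sum_x \int[Pr]_(w in E)
    (W k.+1 (update y k x) * traj_prob s1 (pi k w) P x)%:E)%E).
  apply: lee_sum => x _; apply: le_trans (hx x).2 _.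
  rewrite PrX // -ge0_integralZl_EFin //.
  - by move=> w _; rewrite lee_fin; apply: traj_prob_ge0 => //; exact: hpi.
  - by apply/measurable_EFinP; exact: measurable_traj_prob.
rewrite -ge0_integral_sum //; last 2 first.
- move=> x; apply/measurable_EFinP; apply: measurable_funM => //.
  exact: measurable_traj_prob.
- move=> x w _; rewrite lee_fin; apply: mulr_ge0 => //.
  by apply: traj_prob_ge0 => //; exact: hpi.
rewrite -[leRHS](integral_cst Pr mE); apply: ge0_le_integral => //.
- move=> w _; rewrite sumEFin lee_fin; apply: sumr_ge0 => x _.
  by apply: mulr_ge0 => //; apply: traj_prob_ge0 => //; exact: hpi.
- under eq_fun do rewrite sumEFin.
  apply/measurable_EFinP; apply: measurable_sum => x.
  by apply: measurable_funM => //; exact: measurable_traj_prob.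
- move=> w _; rewrite sumEFin lee_fin; apply: le_trans (hW k y w kK).
  by apply: ler_sum => x _; rewrite mulrC.
Qed.

(** * Bernstein deviations of the empirical kernel *)

(** The quotient [g] of the two sides has derivative exp(- y) y (1/2 - 3/4 y), so on the half-line
    up to 2/3 it is smallest at 0, where it equals 1. The bound 2/3 is the point where the
    derivative changes sign. *)
Lemma expR_le_quadratic (R : realType) (x : R) :
  x <= 2 / 3 -> expR x <= 1 + x + 3 / 4 * x ^+ 2.
Proof.
move=> x23.
pose g (y : R) := (1 + y + 3 / 4 * y ^+ 2) * expR (- y).
pose dg (y : R) := expR (- y) * (y * (1 / 2 - 3 / 4 * y)).
have gd (y : R) : is_derive y 1 g (dg y).
  by apply: is_derive_eq; rewrite /dg /GRing.scale /=; field.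
have gc (a b : R) : {within `[a, b], continuous g}.
  apply: derivable_within_continuous => y _; by have [] := gd y.
have e0 (y : R) : 0 <= expR (- y) by exact: expR_ge0.
suff : 1 <= g x.
  rewrite /g expRN => h; have := expR_gt0 x; move: h; rewrite -ler_pdivrMr ?invr_gt0 ?expR_gt0 //.
  by rewrite invrK mul1r.
have g0 : g 0 = 1 by rewrite /g oppr0 expR0; field.
have [x0|x0|->] := ltgtP x 0; last by rewrite g0.
- have [c] := MVT x0 (fun y _ => gd y) (gc x 0).
  rewrite in_itv /= => /andP[xc c0]; rewrite g0 /dg => e.
  have : 0 <= expR (- c) * (- (c * (1 / 2 - 3 / 4 * c)) * - x).
    by apply: mulr_ge0 => //; apply: mulr_ge0; nra.
  by lra.
- have [c] := MVT x0 (fun y _ => gd y) (gc 0 x).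
  rewrite in_itv /= => /andP[c0 cx]; rewrite g0 /dg => e.
  have : 0 <= expR (- c) * ((c * (1 / 2 - 3 / 4 * c)) * x).
    by apply: mulr_ge0 => //; apply: mulr_ge0; nra.
  by lra.
Qed.

Lemma ln2_ge_half (R : realType) : 1 / 2 <= ln 2 :> R.
Proof.
rewrite -ler_expR lnK ?posrE //.
have := expR_ge1Dx (- (1 / 2) : R); rewrite expRN => h.
rewrite -[leLHS]invrK -[leRHS]invrK lef_pV2 ?posrE ?invr_gt0 ?expR_gt0 //; lra.
Qed.

Lemma expRN1_le_half (R : realType) : expR (- 1) <= 1 / 2 :> R.
Proof.
rewrite expRN div1r lef_pV2 ?posrE ?expR_gt0 //.
by have := expR_ge1Dx (1 : R); lra.
Qed.

(** In the quadratic bound on exp the linear term has mean 0 and the square has the Bernoulli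
    variance as mean; what remains is 1 + phi <= exp phi. *)
Lemma bernoulli_mgf (R : realType) (S : finType) (p : S -> R) (s0 : S) (lam : R) :
  (forall s, 0 <= p s) -> \sum_s p s = 1 -> `|lam| <= 2 / 3 ->
  \sum_s p s * expR (lam * ((s == s0)%:R - p s0)
                     - 3 / 4 * lam ^+ 2 * (p s0 * (1 - p s0))) <= 1.
Proof.
move=> p0 p1 hlam; set phi := 3 / 4 * lam ^+ 2 * _.
have ps1 : p s0 <= 1.
  by rewrite -p1 (bigD1 s0) //= lerDl; apply: sumr_ge0.
have hs0 := p0 s0.
have hl : - (2 / 3) <= lam <= 2 / 3 by rewrite -ler_norml.
apply: (@le_trans _ _ (\sum_s p s * (1 + lam * ((s == s0)%:R - p s0)
    + 3 / 4 * (lam * ((s == s0)%:R - p s0)) ^+ 2) * expR (- phi))).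
  apply: ler_sum => s _; rewrite expRD mulrA; apply: ler_wpM2r.
    exact: expR_ge0.
  apply: ler_wpM2l => //; apply: expR_le_quadratic.
  by case: eqP => _ /=; nra.
rewrite -mulr_suml.
have -> : \sum_s p s * (1 + lam * ((s == s0)%:R - p s0)
    + 3 / 4 * (lam * ((s == s0)%:R - p s0)) ^+ 2) = 1 + phi.
  under eq_bigr => s _.
    rewrite (_ : _ * _ = p s * (1 - lam * p s0 + 3 / 4 * lam ^+ 2 * p s0 ^+ 2)
      + (if s == s0 then p s * (lam + 3 / 4 * lam ^+ 2 * (1 - 2 * p s0)) else 0));
      last by case: eqP => _ /=; field.
    over.
  rewrite big_split /= -mulr_suml p1 -big_mkcond /= big_pred1_eq /phi; by field.
rewrite -(ler_pM2r (expR_gt0 phi)) -mulrA -expRD addNr expR0 mulr1 mul1r.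
exact: expR_ge1Dx.
Qed.

(** With V = n p (1 - p), the exponent lam D - 3/4 lam^2 V at deviation D = 2 sqrt(L V) is maximal
    for lam = 4/3 sqrt(L / V), with value 4/3 L. The cap 2/3 is the range of [expR_le_quadratic]; it
    is active exactly when V <= 4 L. *)
Definition bernstein_rate {R : realType} (p L n : R) : R :=
  if n * (p * (1 - p)) <= 4 * L then 2 / 3
  else 4 / 3 * Num.sqrt (L / (n * (p * (1 - p)))).

Lemma bernstein_rate_bounds (R : realType) (p L n : R) : 0 < L ->
  0 <= bernstein_rate p L n <= 2 / 3.
Proof.
move=> L0; rewrite /bernstein_rate; case: ifPn => [_|]; first by apply/andP; split; lra.
rewrite -ltNge => h.
have v0 : 0 < n * (p * (1 - p)) by lra.
have := sqrtr_ge0 (L / (n * (p * (1 - p)))).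
have : Num.sqrt (L / (n * (p * (1 - p)))) <= Num.sqrt ((1 / 2) ^+ 2).
  rewrite ler_sqrt; last by rewrite exprn_ge0 //; lra.
  by rewrite ler_pdivrMr //; lra.
rewrite sqrtr_sqr ger0_norm; last by lra.
by move=> h1 h2; apply/andP; split; lra.
Qed.

(* Replacing the true variance p (1 - p) by the empirical one q (1 - q) costs at
   most |p - q|, because p (1 - p) - q (1 - q) = (p - q) (1 - p - q). *)
Lemma bernstein_deviation (R : realType) (p q L n : R) :
  0 <= p <= 1 -> 0 <= q <= 1 -> 0 < L -> 0 < n ->
  Num.sqrt (4 * q * (1 - q) * L / n) + 14 * L / 3 / n < `|p - q| ->
  4 / 3 * L <= bernstein_rate p L n * (n * `|p - q|)
    - 3 / 4 * bernstein_rate p L n ^+ 2 * (p * (1 - p)) * n.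
Proof.
move=> /andP[p0 p1] /andP[q0 q1] L0 n0; set u := Num.sqrt _; set e := `|p - q|.
move=> he; have u0 : 0 <= u by exact: sqrtr_ge0.
have x0 : 0 < L / n by exact: divr_gt0.
have xn : L / n * n = L by field; lra.
move: x0 xn he; rewrite (_ : 14 * L / 3 / n = 14 / 3 * (L / n)); last by field; lra.
move=> x0 xn he.
have u2 : u ^+ 2 = 4 * (q * (1 - q)) * (L / n).
  rewrite sqr_sqrtr; first by field; lra.
  by apply: divr_ge0; [apply: mulr_ge0; [apply: mulr_ge0|]|]; lra.
have vw : p * (1 - p) <= q * (1 - q) + e.
  have e1 : `|(p - q) * (1 - p - q)| <= e.
    rewrite normrM -[leRHS]mulr1; apply: ler_wpM2l => //.
    by rewrite ler_norml; lra.
  have := le_trans (ler_norm _) e1; lra.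
have v0 : 0 <= p * (1 - p) by apply: mulr_ge0; lra.
rewrite /bernstein_rate; case: ifPn => [h|].
  (* At rate 2/3 the exponent is at least 2/3 * 14/3 L - 1/3 * 4 L = 16/9 L. *)
  have : 14 / 3 * L <= n * e.
    rewrite -xn; have : 14 / 3 * (L / n) <= e by lra.
    by move=> /(ler_wpM2l (ltW n0)); lra.
  by lra.
rewrite -ltNge => h; have nv : 0 < n * (p * (1 - p)) by lra.
set r := Num.sqrt _.
have r0 : 0 <= r by exact: sqrtr_ge0.
have r2 : r ^+ 2 * (n * (p * (1 - p))) = L.
  rewrite sqr_sqrtr; first by rewrite divfK ?lt0r_neq0.
  by rewrite ltW // divr_gt0.
suff H : 2 * L <= r * (n * e).
  have -> : 3 / 4 * (4 / 3 * r) ^+ 2 * (p * (1 - p)) * n = 4 / 3 * L.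
    by rewrite -r2; field.
  by lra.
have ne0 : 0 <= r * (n * e).
  by apply: mulr_ge0 => //; apply: mulr_ge0; [exact: ltW|exact: normr_ge0].
rewrite -(ler_pXn2r (ltn0Sn 1)) ?nnegrE //; last by lra.
(* The linear term 14/3 L / n of the width exceeds 4 L / n, so it pays for the error [e] made in
   passing from q (1 - q) to p (1 - p). *)
have ne : 4 * L * (p * (1 - p)) <= n * e ^+ 2.
  have e0 : 0 <= e by exact: normr_ge0.
  have : e * (u + 14 / 3 * (L / n)) <= e * e by apply: ler_wpM2l => //; lra.
  have : u * u <= e * u by apply: ler_wpM2r => //; lra.
  rewrite -[u * u]expr2 u2 => h1 h2.
  have h3 : 4 * (L / n) * (p * (1 - p)) <= e * e.
    have : 4 * (L / n) * (p * (1 - p)) <= 4 * (L / n) * (q * (1 - q) + e).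
      by apply: ler_wpM2l => //; lra.
    have : 0 <= e * (L / n) by rewrite mulr_ge0 // ltW.
    by lra.
  move/(ler_wpM2l (ltW n0)): h3; rewrite -[e * e]expr2.
  have -> : n * (4 * (L / n) * (p * (1 - p))) = 4 * (L / n * n) * (p * (1 - p)).
    by move: (L / n) => x; ring.
  by rewrite xn.
rewrite -(ler_pM2r nv).
have -> : (r * (n * e)) ^+ 2 * (n * (p * (1 - p))) =
    r ^+ 2 * (n * (p * (1 - p))) * n * (n * e ^+ 2) by ring.
rewrite r2.
have : L * n * (4 * L * (p * (1 - p))) <= L * n * (n * e ^+ 2).
  by apply: ler_wpM2l => //; rewrite mulr_ge0 // ltW.
lra.
Qed.

(** * Visit counts and processes stopped at a given count *)

Lemma visits_ext (S A : finType) (T : nat) (y y' : nat -> trajectory S A T)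
  (k : nat) (t : 'I_T) (s : S) (a : A) :
  (forall j, (0 < j < k)%N -> y j = y' j) -> visits y k t s a = visits y' k t s a.
Proof. by move=> yy'; apply: eq_big_nat => j jk; rewrite yy'. Qed.

Lemma transitions_ext (S A : finType) (T : nat) (y y' : nat -> trajectory S A T)
  (k : nat) (t : 'I_T) (s : S) (a : A) (s' : S) :
  (forall j, (0 < j < k)%N -> y j = y' j) ->
  transitions y k t s a s' = transitions y' k t s a s'.
Proof. by move=> yy'; apply: eq_big_nat => j jk; rewrite yy'. Qed.

Lemma beta3_ext (R : realType) (S A : finType) (T K : nat) (delta : R)
  (y y' : nat -> trajectory S A T) (k : nat) (t : 'I_T) (s : S) (a : A) (s' : S) :
  (forall j, (0 < j < k)%N -> y j = y' j) ->
  beta3 K delta y k t s a s' = beta3 K delta y' k t s a s'.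
Proof.
move=> yy'; rewrite /beta3 /P_hat /visits1.
by rewrite (visits_ext _ _ _ yy') (transitions_ext _ _ _ _ yy').
Qed.

Lemma leq_visits (S A : finType) (T : nat) (y : nat -> trajectory S A T)
  (j k : nat) (t : 'I_T) (s : S) (a : A) :
  (j <= k)%N -> (visits y j t s a <= visits y k t s a)%N.
Proof.
move=> jk; have [j1|j1] := leqP j 1.
  by rewrite /visits big_geq.
by rewrite /visits (@big_cat_nat _ _ _ j 1 k) //= ?leq_addr // ltnW.
Qed.

Lemma visits_recr (S A : finType) (T : nat) (y : nat -> trajectory S A T)
  (k : nat) (t : 'I_T) (s : S) (a : A) : (0 < k)%N ->
  visits y k.+1 t s a =
  (visits y k t s a + ((state (y k) t == s) && (action (y k) t == a)))%N.
Proof. by move=> k0; rewrite /visits big_nat_recr. Qed.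

Lemma sum_transitions (S A : finType) (T : nat) (y : nat -> trajectory S A T)
  (k : nat) (t : 'I_T) (s : S) (a : A) :
  (\sum_s' transitions y k t s a s')%N = visits y k t s a.
Proof.
rewrite /transitions exchange_big /=; apply: eq_bigr => j _.
rewrite (bigD1 (next_state (y j) t)) //= eqxx andbT.
by rewrite big1 ?addn0 // => s' /negbTE; rewrite eq_sym => ->; rewrite !andbF.
Qed.

Lemma leq_transitions (S A : finType) (T : nat) (y : nat -> trajectory S A T)
  (k : nat) (t : 'I_T) (s : S) (a : A) (s' : S) :
  (transitions y k t s a s' <= visits y k t s a)%N.
Proof. by rewrite -sum_transitions (bigD1 s') //= leq_addr. Qed.

Lemma visits1_gt0 (R : realType) (S A : finType) (T : nat)
  (y : nat -> trajectory S A T) (k : nat) (t : 'I_T) (s : S) (a : A) :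
  0 < visits1 y k t s a :> R.
Proof. by rewrite /visits1 ltr0n leq_max orbT. Qed.

Lemma P_hat_bounds (R : realType) (S A : finType) (T : nat)
  (y : nat -> trajectory S A T) (k : nat) (t : 'I_T) (s : S) (a : A) (s' : S) :
  0 <= (P_hat y k t s a s' : R) <= 1.
Proof.
rewrite /P_hat; have v0 := visits1_gt0 R y k t s a.
rewrite divr_ge0 //=.
rewrite ler_pdivrMr // mul1r ler_nat leq_max leq_transitions //.
Qed.

(* Stopping the count after [n] visits makes the deviation after exactly [n] visits a
   deviation at the final time. *)
Definition stopped {R : realType} {S A : finType} {T : nat}
    (y : nat -> trajectory S A T) (k : nat) (t : 'I_T) (s : S) (a : A) (n : nat)
    (h : S -> R) : R :=
  \sum_(1 <= j < k) [&& (visits y j t s a < n)%N, state (y j) t == s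
                      & action (y j) t == a]%:R * h (next_state (y j) t).

Lemma update_lt (X : Type) (y : nat -> X) (k j : nat) (x : X) :
  (j < k)%N -> update y k x j = y j.
Proof. by move=> jk; rewrite /update ltn_eqF. Qed.

Lemma stopped_update (R : realType) (S A : finType) (T : nat)
  (y : nat -> trajectory S A T) (k : nat) (x : trajectory S A T)
  (t : 'I_T) (s : S) (a : A) (n : nat) (h : S -> R) : (0 < k)%N ->
  stopped (update y k x) k.+1 t s a n h = stopped y k t s a n h +
    [&& (visits y k t s a < n)%N, state x t == s & action x t == a]%:R
      * h (next_state x t).
Proof.
move=> k0; rewrite /stopped big_nat_recr //=; congr (_ + _).
  apply: eq_big_nat => j /andP[j0 jk]; rewrite update_lt //.
  rewrite (@visits_ext _ _ _ _ y) // => i /andP[_ ij].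
  by rewrite update_lt // (ltn_trans ij).
rewrite (@visits_ext _ _ _ _ y); last first.
  by move=> i /andP[_ ij]; rewrite update_lt.
by rewrite /update eqxx.
Qed.

(** Whether the count is still below [n] is known before episode [k]. If it is and the pair is
    visited, the conditional mean of the new factor is at most 1 by hypothesis; otherwise the factor
    is 1. *)
Lemma stopped_supermartingale (R : realType) (S A : finType) (T : nat) (s1 : S)
  (pi : policy R S A T) (P : transition_kernel R S A T)
  (y : nat -> trajectory S A T) (k : nat) (t : 'I_T) (s : S) (a : A) (n : nat)
  (h : S -> R) :
  (0 < k)%N -> is_policy pi -> is_kernel P ->
  \sum_s' P t s a s' * expR (h s') <= 1 ->
  expect s1 pi P (fun x => expR (stopped (update y k x) k.+1 t s a n h))
    <= expR (stopped y k t s a n h).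
Proof.
move=> k0 hpi hP hh.
pose g s' a' s'' :=
  expR ([&& (visits y k t s a < n)%N, s' == s & a' == a]%:R * h s'').
rewrite [leLHS](_ : _ = expR (stopped y k t s a n h) * expect s1 pi P (fun x =>
    g (state x t) (action x t) (next_state x t))); last first.
  rewrite -expectZ; apply: eq_bigr => x _.
  by rewrite stopped_update // expRD.
rewrite -[leRHS]mulr1; apply: ler_wpM2l; first exact: expR_ge0.
apply: expect_transition_le1 => // s' a'; rewrite /g.
have [/and3P[_ /eqP -> /eqP ->]|_] := boolP [&& _, _ & _].
  by under eq_bigr do rewrite mul1r.
rewrite -[leRHS](hP t s' a').2; apply: ler_sum => s'' _.
by rewrite mul0r expR0 mulr1.
Qed.

(** When the threshold is the count at [k], each visit before [k] happens while the count is still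
    below it, and from [k] on the process is frozen. *)
Lemma stopped_eq (R : realType) (S A : finType) (T : nat)
  (y : nat -> trajectory S A T) (k k' : nat) (t : 'I_T) (s : S) (a : A)
  (h : S -> R) : (0 < k <= k')%N ->
  stopped y k' t s a (visits y k t s a) h =
  \sum_(1 <= j < k) ((state (y j) t == s) && (action (y j) t == a))%:R
     * h (next_state (y j) t).
Proof.
move=> /andP[k0 kk']; rewrite /stopped (@big_cat_nat _ _ _ k) //=.
rewrite [X in _ + X]big_nat_cond [X in _ + X]big1 ?addr0; last first.
  move=> j; rewrite andbT => /andP[kj _].
  by rewrite ltnNge (leq_visits _ _ _ _ kj) mul0r.
apply: eq_big_nat => j /andP[j0 jk]; congr (_ %:R * _).
case vj: ((state _ t == s) && _); rewrite ?andbF // andbT.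
have := leq_visits y t s a jk; rewrite visits_recr // vj addn1.
by move=> ->.
Qed.

(** The tilted deviation minus its log-moment bound; [b] picks the sign, so that both tails are
    covered. *)
Definition bernstein_increment {R : realType} {S : finType} (p : S -> R) (L : R)
    (s0 : S) (n : nat) (b : bool) (s : S) : R :=
  let lam := (-1) ^+ b * bernstein_rate (p s0) L n%:R in
  lam * ((s == s0)%:R - p s0) - 3 / 4 * lam ^+ 2 * (p s0 * (1 - p s0)).

Lemma bernstein_increment_mgf (R : realType) (S : finType) (p : S -> R) (L : R)
  (s0 : S) (n : nat) (b : bool) :
  0 < L -> (forall s, 0 <= p s) -> \sum_s p s = 1 ->
  \sum_s p s * expR (bernstein_increment p L s0 n b s) <= 1.
Proof.
move=> L0 p0 p1; apply: bernoulli_mgf => //.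
have /andP[r0 r1] := bernstein_rate_bounds (p s0) n%:R L0.
by rewrite normrM normrX normrN1 expr1n mul1r ger0_norm.
Qed.

Lemma confidence_failure (R : realType) (S A : finType) (T K : nat) (delta : R)
  (P : transition_kernel R S A T) (y : nat -> trajectory S A T) (k k' : nat)
  (t : 'I_T) (s : S) (a : A) (s' : S) :
  let L := @logfactor R S A T K delta in
  1 / 2 <= L -> is_kernel P -> (0 < k <= k')%N ->
  beta3 K delta y k t s a s' < `|P t s a s' - P_hat y k t s a s'| ->
  exists b, 4 / 3 * L <= stopped y k' t s a (visits y k t s a)
    (bernstein_increment (P t s a) L s' (visits y k t s a) b).
Proof.
move=> L hL hP kk' hdev.
have L0 : 0 < L by lra.
have /andP[q0 q1] := P_hat_bounds R y k t s a s'.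
have p0 : 0 <= P t s a s' by have [] := hP t s a.
have p1 : P t s a s' <= 1.
  have [h <-] := hP t s a.
  by rewrite (bigD1 s') //= lerDl; apply: sumr_ge0.
(* At an unvisited triple the width is at least 14/3 L >= 1, so no failure can occur there. *)
have n0 : (0 < visits y k t s a)%N.
  rewrite lt0n; apply/eqP => n0; move: hdev.
  rewrite /beta3 /visits1 n0 maxnC /= -/L.
  apply/negP; rewrite -leNgt; apply: (@le_trans _ _ 1).
    by rewrite ler_norml; lra.
  by rewrite maxn0 !divr1 -[leLHS]add0r; apply: lerD; [exact: sqrtr_ge0|lra].
have vE : visits1 y k t s a = (visits y k t s a)%:R :> R.
  by rewrite /visits1; congr (_%:R); apply/maxn_idPl.
have n0' : 0 < (visits y k t s a)%:R :> R by rewrite ltr0n.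
move: hdev; rewrite /beta3 vE -/L => hdev.
have := @bernstein_deviation R _ _ L _ _ _ L0 n0' hdev.
rewrite p0 p1 q0 q1 => /(_ isT isT) hb.
exists (P_hat y k t s a s' < P t s a s').
rewrite stopped_eq //; set b := _ < _; set n := visits y k t s a.
pose lam : R := (-1) ^+ b * bernstein_rate (P t s a s') L n%:R.
have -> : \sum_(1 <= j < k) ((state (y j) t == s) && (action (y j) t == a))%:R
     * bernstein_increment (P t s a) L s' n b (next_state (y j) t) =
  lam * ((transitions y k t s a s')%:R - P t s a s' * n%:R)
  - 3 / 4 * lam ^+ 2 * (P t s a s' * (1 - P t s a s')) * n%:R.
  rewrite /n /transitions /visits !natr_sum -/n !mulr_sumr -sumrB !mulr_sumr -sumrB.
  apply: eq_bigr => j _; rewrite /bernstein_increment -/lam.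
  by case: (_ == s); case: (_ == a); case: (_ == s') => /=; field.
have qn : (transitions y k t s a s')%:R = P_hat y k t s a s' * n%:R :> R.
  by rewrite /P_hat vE divfK // gt_eqF.
rewrite qn -mulrBl.
have lam2 : lam ^+ 2 = bernstein_rate (P t s a s') L n%:R ^+ 2.
  by rewrite exprMn -exprM mulnC exprM sqrrN !expr1n mul1r.
rewrite lam2; apply: le_trans hb _; rewrite lerD2r /lam.
rewrite [leRHS](_ : _ = bernstein_rate (P t s a s') L n%:R *
  (n%:R * ((-1) ^+ b * (P_hat y k t s a s' - P t s a s')))); last by ring.
suff -> : (-1) ^+ b * (P_hat y k t s a s' - P t s a s') =
  `|P t s a s' - P_hat y k t s a s'| by [].
rewrite /b; case: ltP => h /=.
  by rewrite expr1 mulN1r opprB ger0_norm // subr_ge0 ltW.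
by rewrite expr0 mul1r distrC ger0_norm // subr_ge0.
Qed.

(** * Warm-up visits and the union bound *)

Definition occupancy {R : realType} {S A : finType} {T : nat} (s1 : S)
    (pi : policy R S A T) (P : transition_kernel R S A T) (t : 'I_T) (s : S) (a : A) : R :=
  expect s1 pi P (fun x => ((state x t == s) && (action x t == a))%:R).

(** An indicator Z of mean q satisfies E exp(- Z) <= 1 - q / 2 <= exp(- q / 2), the first step
    because exp(- 1) <= 1/2. This is where the warm-up bound gets its factor 1/2. *)
Lemma occupancy_mgf (R : realType) (S A : finType) (T : nat) (s1 : S)
  (pi : policy R S A T) (P : transition_kernel R S A T) (t : 'I_T) (s : S) (a : A) :
  is_policy pi -> is_kernel P ->
  expect s1 pi P (fun x => expR (occupancy s1 pi P t s a / 2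
    - ((state x t == s) && (action x t == a))%:R)) <= 1.
Proof.
move=> hpi hP; set q := occupancy _ _ _ _ _ _.
apply: (@le_trans _ _ (expect s1 pi P (fun x => expR (q / 2) * (1 +
    (- (1 / 2)) * ((state x t == s) && (action x t == a))%:R)))).
  apply: ler_expect => // x; rewrite expRD; apply: ler_wpM2l.
    exact: expR_ge0.
  case: (_ && _) => /=; last by rewrite oppr0 expR0 mulr0 addr0.
  by have := expRN1_le_half R; lra.
rewrite expectZ expectD expectZ expect_cst // -/q.
rewrite -[leRHS](expR0 R) -(subrr (q / 2)) expRD.
apply: ler_wpM2l; first exact: expR_ge0.
have := expR_ge1Dx (- (q / 2)).
by rewrite -/(occupancy s1 pi P t s a) -/q; lra.
Qed.

(** A set of trajectory sequences rather than of outcomes, as the supermartingale bound requires.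
    [visits y k] counts the episodes before [k], so [K0.+1] covers the whole warm-up. *)
Definition unreliable {R : realType} {S A : finType} {T : nat} (K K0 : nat)
    (delta : R) (s1 : S) (P : transition_kernel R S A T) (pi0 : policy R S A T) :
    set (nat -> trajectory S A T) :=
  [set y | (exists k t s a s', (0 < k <= K)%N /\
              beta3 K delta y k t s a s' < `|P t s a s' - P_hat y k t s a s'|)
        \/ (exists t s a, (visits y K0.+1 t s a)%:R <
              K0%:R * occupancy s1 pi0 P t s a / 2
              - @logfactor R S A T K delta)].

Lemma visits_ub (S A : finType) (T : nat) (y : nat -> trajectory S A T)
  (k : nat) (t : 'I_T) (s : S) (a : A) : (visits y k t s a <= k.-1)%N.
Proof.
have -> : k.-1 = (\sum_(1 <= j < k) 1)%N by rewrite sum_nat_const_nat muln1 subn1.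
by apply: leq_sum => j _; case: (_ && _).
Qed.

Lemma expect_sum_le (R : realType) (S A I : finType) (T : nat) (s1 : S)
  (pi : policy R S A T) (P : transition_kernel R S A T)
  (f : I -> trajectory S A T -> R) (c : I -> R) :
  (forall i, expect s1 pi P (f i) <= c i) ->
  expect s1 pi P (fun x => \sum_i f i x) <= \sum_i c i.
Proof. by move=> h; rewrite expect_sum; apply: ler_sum => i _; exact: h. Qed.

(** Each exponential process is scaled to reach 1 at its failure threshold, so [W] is at least 1 on
    the whole bad event. Its initial value counts the processes: at most delta from the Bernstein
    family [f] and at most delta from the warm-up family [g]. *)
Lemma unreliable_unlikely (R : realType) (disp : measure_display)
  (Omega : measurableType disp) (S A : finType) (T K K0 : nat) (delta : R)
  (Pr : probability Omega R) (s1 : S) (P : transition_kernel R S A T)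
  (F : nat -> set_system Omega) (X : nat -> Omega -> trajectory S A T)
  (b : nat -> Omega -> R) (pi : nat -> Omega -> policy R S A T)
  (pi0 : policy R S A T) :
  let L := @logfactor R S A T K delta in
  interaction Pr K s1 P F X b pi -> is_kernel P -> is_policy pi0 ->
  (forall k w, (0 < k <= K)%N -> is_policy (pi k w)) ->
  (forall k w, (0 < k <= K)%N -> (k <= K0)%N -> pi k w = pi0) ->
  (K0 <= K)%N -> (0 < K)%N -> 0 < delta -> 1 / 2 <= L ->
  expR (- L) * (2 * #|S|%:R * #|A|%:R * T%:R * K%:R) = delta ->
  #|S|%:R ^+ 3 <= expR L ->
  measurable [set w | unreliable K K0 delta s1 P pi0 (X ^~ w)] /\
  (Pr [set w | unreliable K K0 delta s1 P pi0 (X ^~ w)] <= (2 * delta)%:E)%E.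
Proof.
move=> L hint hP hpi0 hpi hbase K0K Kpos delta0 hL hexp hS.
have L0 : 0 < L by lra.
pose q t s a := occupancy s1 pi0 P t s a.
pose f (i : 'I_T * S * A * S * 'I_K * bool) k y : R :=
  let: (t, s, a, s', n, c) := i in
  expR (- (4 / 3 * L)) *
  expR (stopped y k t s a n (bernstein_increment (P t s a) L s' n c)).
(* Only warm-up episodes enter: after [K0] the process is frozen, as other policies have other
   occupancies. *)
pose g (i : 'I_T * S * A) k (y : nat -> trajectory S A T) : R :=
  let: (t, s, a) := i in
  expR (- L) * expR (\sum_(1 <= j < k | (j <= K0)%N)
     (q t s a / 2 - ((state (y j) t == s) && (action (y j) t == a))%:R)).
pose W k y := \sum_i f i k y + \sum_i g i k y.
have f0 i k y : 0 <= f i k y.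
  by move: i => [[[[[t s] a] s'] n] c]; rewrite mulr_ge0 ?expR_ge0.
have g0 i k y : 0 <= g i k y.
  by move: i => [[t s] a]; rewrite mulr_ge0 ?expR_ge0.
have W0 k y : 0 <= W k y by apply: addr_ge0; apply: sumr_ge0.
have hf k y w i : (0 < k <= K)%N ->
    expect s1 (pi k w) P (fun x => f i k.+1 (update y k x)) <= f i k y.
  move=> kK; move: i => [[[[[t s] a] s'] n] c]; rewrite expectZ.
  apply: ler_wpM2l; first exact: expR_ge0.
  apply: stopped_supermartingale => //; [by case/andP: kK|exact: hpi|].
  by apply: bernstein_increment_mgf => //; have [] := hP t s a.
have hg k y w i : (0 < k <= K)%N ->
    expect s1 (pi k w) P (fun x => g i k.+1 (update y k x)) <= g i k y.
  move=> kK; move: i => [[t s] a]; rewrite expectZ.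
  apply: ler_wpM2l; first exact: expR_ge0.
  set c := fun x => _.
  have k1 : (0 < k)%N by case/andP: kK.
  set s0 := \sum_(1 <= j < k | _) _.
  have e x : \sum_(1 <= j < k.+1 | (j <= K0)%N) (q t s a / 2 -
      ((state (update y k x j) t == s) && (action (update y k x j) t == a))%:R)
    = s0 + (if (k <= K0)%N then
        q t s a / 2 - ((state x t == s) && (action x t == a))%:R else 0).
    rewrite big_mkcond big_nat_recr //= /update eqxx; congr (_ + _).
    rewrite /s0 [RHS]big_mkcond; apply: eq_big_nat => j /andP[_ jk].
    by rewrite ltn_eqF.
  have -> : c = fun x => expR s0 * expR (if (k <= K0)%N then
        q t s a / 2 - ((state x t == s) && (action x t == a))%:R else 0).
    by apply/funext => x; rewrite /c e expRD.
  rewrite expectZ -[leRHS]mulr1; apply: ler_wpM2l; first exact: expR_ge0.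
  have [kK0|kK0] := boolP (k <= K0)%N; last by rewrite expR0 expect_cst //; exact: hpi.
  by rewrite hbase //; exact: occupancy_mgf.
(* A sample point supplies the starting history; total mass 1 excludes an empty [Omega]. *)
have [w0] : exists w : Omega, True.
  apply: contrapT => h; have := @probability_setT _ _ _ Pr.
  rewrite (_ : [set: Omega] = set0) ?measure0.
    by move/eqP; rewrite eq_sym onee_eq0.
  by apply/seteqP; split=> // w _; apply: h; exists w.
have [|||mB leB] := @interaction_supermartingale R disp Omega S A T K Pr s1 P F X
  b pi (unreliable K K0 delta s1 P pi0) W (X ^~ w0) hint hP hpi W0.
- move=> k y w kK; rewrite /W expectD; apply: lerD; apply: expect_sum_le => i.
    exact: hf.
  exact: hg.
- move=> y y' yy' [[k [t [s [a [s' [kK h]]]]]]|[t [s [a h]]]].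
    left; exists k, t, s, a, s'; split=> //; move: h.
    have e j : (0 < j < k)%N -> y j = y' j by move=> jk; apply: yy'; lia.
    rewrite (beta3_ext _ _ _ _ _ _ e) /P_hat /visits1.
    by rewrite (visits_ext _ _ _ e) (transitions_ext _ _ _ _ e).
  right; exists t, s, a; rewrite -(@visits_ext _ _ _ y) //.
  by move=> j jK; apply: yy'; lia.
- move=> y [[k [t [s [a [s' [kK h]]]]]]|[t [s [a h]]]].
    have kK1 : (0 < k <= K.+1)%N by lia.
    have [c hc] := confidence_failure hL hP kK1 h.
    (* Fewer than [k <= K] episodes precede episode [k], so the counts are indexed by ['I_K]. *)
    have nK : (visits y k t s a < K)%N.
      by apply: leq_ltn_trans (visits_ub _ _ _ _ _) _; lia.
    rewrite /W -[leLHS]addr0; apply: lerD; last exact: sumr_ge0.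
    rewrite (bigD1 (t, s, a, s', Ordinal nK, c)) //= -[leLHS]addr0.
    apply: lerD; last exact: sumr_ge0.
    by rewrite -expRD -[leLHS](expR0 R) ler_expR addrC subr_ge0.
  rewrite /W -[leLHS]add0r; apply: lerD; first exact: sumr_ge0.
  rewrite (bigD1 (t, s, a)) //= -[leLHS]addr0; apply: lerD; last exact: sumr_ge0.
  rewrite -expRD -[leLHS](expR0 R) ler_expR.
  have -> : \sum_(1 <= j < K.+1 | (j <= K0)%N)
      (q t s a / 2 - ((state (y j) t == s) && (action (y j) t == a))%:R)
      = K0%:R * q t s a / 2 - (visits y K0.+1 t s a)%:R.
    rewrite (@big_cat_nat _ _ _ K0.+1) //= [X in _ + X]big_nat_cond.
    rewrite [X in _ + X]big1 ?addr0; last by move=> j; lia.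
    rewrite big_nat_cond (eq_bigl (fun j => (1 <= j < K0.+1)%N)); last by move=> j; lia.
    rewrite -big_nat sumrB natr_sum; congr (_ - _).
    by rewrite sumr_const_nat subn1 /= -[LHS]mulr_natl mulrA.
  by move: h; rewrite -/L -/(q t s a); lra.
split=> //; apply: le_trans leB _; rewrite lee_fin /W.
have f1 i : f i 1%N (X ^~ w0) = expR (- (4 / 3 * L)).
  by move: i => [[[[[t s] a] s'] n] c]; rewrite /f /stopped big_geq // expR0 mulr1.
have g1 i : g i 1%N (X ^~ w0) = expR (- L).
  by move: i => [[t s] a]; rewrite /g big_geq // expR0 mulr1.
rewrite (eq_bigr _ (fun i _ => f1 i)) (eq_bigr _ (fun i _ => g1 i)).
rewrite !sumr_const !cardT -!cardE !card_prod !card_ord card_bool.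
rewrite -!(mulr_natr (expR _)) !natrM.
set nT := T%:R; set nS := #|S|%:R; set nA := #|A|%:R; set nK := K%:R.
have eL3 : nS <= expR (L / 3).
  rewrite -(@ler_pXn2r _ 3) ?nnegrE ?expR_ge0 //.
  rewrite -expRM_natl (_ : 3 * (L / 3) = L) //; by field.
have [nT0 nS0 nA0] : [/\ 0 <= nT, 0 <= nS & 0 <= nA] by [].
have nK1 : 1 <= nK by rewrite ler1n.
have e1 : expR (- (4 / 3 * L)) * (nT * nS * nA * nS * nK * 2) <= delta.
  have -> : expR (- (4 / 3 * L)) = expR (- L) * expR (- (L / 3)).
    by rewrite -expRD; congr expR; field.
  rewrite -hexp (_ : _ * _ = expR (- L) * (2 * nS * nA * nT * nK) *
    (nS * expR (- (L / 3)))); last by ring.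
  rewrite -[leRHS]mulr1; apply: ler_wpM2l.
    by rewrite mulr_ge0 ?expR_ge0 // !mulr_ge0 //; lra.
  by rewrite expRN ler_pdivrMr ?expR_gt0 // mul1r.
have e2 : expR (- L) * (nT * nS * nA) <= delta.
  rewrite -hexp; apply: ler_wpM2l; first exact: expR_ge0.
  have : 0 <= nT * nS * nA by rewrite !mulr_ge0.
  have -> : 2 * nS * nA * nT * nK = (nT * nS * nA) * (2 * nK) by ring.
  by move=> h; rewrite -[leLHS]mulr1; apply: ler_wpM2l => //; lra.
lra.
Qed.

(** * Cost of the baseline under the optimistic consumption *)

Lemma expect_stage (R : realType) (S A : finType) (T : nat) (s1 : S)
  (pi : policy R S A T) (P : transition_kernel R S A T) (t : 'I_T)
  (g : S -> A -> R) :
  expect s1 pi P (fun x => g (state x t) (action x t)) =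
  \sum_s \sum_a occupancy s1 pi P t s a * g s a.
Proof.
have -> : (fun x => g (state x t) (action x t)) = (fun x : trajectory S A T =>
    \sum_s \sum_a g s a * ((state x t == s) && (action x t == a))%:R).
  apply/funext => x; rewrite (bigD1 (state x t)) //= [X in _ + X]big1 ?addr0.
    rewrite (bigD1 (action x t)) //= [X in _ + X]big1 ?addr0 ?eqxx ?mulr1 //.
    by move=> a /negbTE na; rewrite [_ == a]eq_sym na andbF mulr0.
  move=> s /negbTE ns; rewrite big1 // => a _.
  by rewrite [_ == s]eq_sym ns mulr0.
rewrite expect_sum; apply: eq_bigr => s _; rewrite expect_sum.
by apply: eq_bigr => a _; rewrite expectZ mulrC.
Qed.

Lemma value_occupancy (R : realType) (S A : finType) (T : nat) (s1 : S)
  (r : stagefun R S A T) (pi : policy R S A T) (P : transition_kernel R S A T) :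
  value s1 r pi P = \sum_(t < T) \sum_s \sum_a occupancy s1 pi P t s a * r t s a.
Proof. by rewrite valueE expect_sum; apply: eq_bigr => t _; rewrite -expect_stage. Qed.

Lemma occupancy_ge0 (R : realType) (S A : finType) (T : nat) (s1 : S)
  (pi : policy R S A T) (P : transition_kernel R S A T) (t : 'I_T) (s : S) (a : A) :
  is_policy pi -> is_kernel P -> 0 <= occupancy s1 pi P t s a.
Proof.
by move=> hpi hP; apply: sumr_ge0 => x _; rewrite mulr_ge0 // traj_prob_ge0.
Qed.

Lemma sum_occupancy (R : realType) (S A : finType) (T : nat) (s1 : S)
  (pi : policy R S A T) (P : transition_kernel R S A T) (t : 'I_T) :
  is_policy pi -> is_kernel P -> \sum_s \sum_a occupancy s1 pi P t s a = 1.
Proof.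
move=> hpi hP; rewrite -(expect_cst s1 1 hpi hP).
rewrite (expect_stage s1 pi P t (fun _ _ => 1)).
by apply: eq_bigr => s _; apply: eq_bigr => a _; rewrite mulr1.
Qed.

(* If q K0 <= 4 L, the trivial bound 7 L on the confidence width suffices; otherwise
   N >= q K0 / 4 and the square root is split by AM-GM with weight al. *)
Lemma weighted_width (R : realType) (q x N L k al : R) :
  0 <= q -> 0 <= x <= 1 -> 1 <= N -> 1 / 2 <= L -> 0 < k -> 0 < al ->
  k * q / 2 - L <= N ->
  q * (Num.sqrt (4 * x * (1 - x) * L / N) + 14 * L / 3 / N) <=
  al / 2 * q * x + (8 * L / al + 19 * L + 28 * L ^+ 2) / k.
Proof.
move=> q0 /andP[x0 x1] N1 hL k0 al0 hN.
have N0 : 0 < N by lra.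
have N0' : N != 0 by rewrite gt_eqF.
have L0 : 0 < L by lra.
set r := Num.sqrt _.
have r0 : 0 <= r by exact: sqrtr_ge0.
have xx : 0 <= 4 * x * (1 - x) <= 1.
  apply/andP; split; first by rewrite !mulr_ge0 //; lra.
  by have := sqr_ge0 (2 * x - 1); rewrite expr2; lra.
have rr : r ^+ 2 = 4 * x * (1 - x) * L / N.
  by rewrite sqr_sqrtr // divr_ge0 // ?mulr_ge0 //; lra.
have rN : r ^+ 2 * N = 4 * x * (1 - x) * L by rewrite rr divfK.
have w0 : 0 <= 8 * L / al by rewrite divr_ge0 //; lra.
rewrite -(ler_pM2r k0) [leRHS]mulrDl divfK ?gt_eqF //.
have [small|large] := leP (k * q) (4 * L).
  have r1 : r <= 3 / 2 * L.
    rewrite -(@ler_pXn2r _ 2) ?nnegrE //; last lra.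
    have : r ^+ 2 <= L.
      rewrite rr ler_pdivrMr //; case/andP: xx => _ xx.
      have : 4 * x * (1 - x) * L <= 1 * L by apply: ler_wpM2r => //; lra.
      by nra.
    by nra.
  have b1 : 14 * L / 3 / N <= 14 * L / 3.
    by rewrite ler_pdivrMr // ler_peMr //; lra.
  have b2 : r + 14 * L / 3 / N <= 7 * L by lra.
  have b0 : 0 <= 14 * L / 3 / N by rewrite divr_ge0 //; lra.
  have : (k * q) * (r + 14 * L / 3 / N) <= 4 * L * (7 * L).
    by apply: ler_pM => //; [rewrite mulr_ge0 //; lra|lra].
  have : 0 <= al / 2 * q * x * k by rewrite !mulr_ge0 //; lra.
  by lra.
have N4 : k * q / 4 <= N by lra.
have b1 : k * q * (14 * L / 3 / N) <= 19 * L.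
  rewrite mulrA ler_pdivrMr //.
  have : L * (k * q / 4) <= L * N by apply: ler_wpM2l => //; lra.
  have : 0 <= L * N by rewrite mulr_ge0 //; lra.
  by lra.
(* From N >= k q / 4 follows (k q r)^2 <= 16 k q x L, which is 4 times the product of the two terms
   on the right. *)
have b2 : k * q * r <= al / 2 * q * x * k + 8 * L / al.
  set z := 8 * L / al.
  rewrite -(@ler_pXn2r _ 2) ?nnegrE ?addr_ge0 ?mulr_ge0 ?invr_ge0 //; try lra.
  apply: (@le_trans _ _ (4 * (al / 2 * q * x * k) * z)); last first.
    by have := sqr_ge0 (al / 2 * q * x * k - z); rewrite !expr2; lra.
  have -> : 4 * (al / 2 * q * x * k) * z = 16 * (k * q) * x * L.
    by rewrite /z; field; rewrite gt_eqF.
  have : (k * q) * (r ^+ 2 * (k * q / 4)) <= (k * q) * (r ^+ 2 * N).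
    by do 2?apply: ler_wpM2l => //; [lra|exact: sqr_ge0].
  rewrite rN.
  have : k * q * (4 * x * (1 - x) * L) <= k * q * (4 * x * L).
    apply: ler_wpM2l; first lra.
    by apply: ler_wpM2r; [lra|nra].
  rewrite !exprMn; lra.
have b3 : 0 <= 28 * L ^+ 2 by rewrite mulr_ge0 // sqr_ge0.
by move: b1 b2 b3; move: (14 * L / 3 / N) (8 * L / al) => w z *; lra.
Qed.

(** This [al] gives the first-order part exactly [ga / 4]. The lower bound on [k] leaves at most
    32/200 of [ga] for the term in 1 / al and 66/200 for the rest, where 66 = 2 * 19 + 28 by L <= 2
    L^2. *)
Lemma width_budget (R : realType) (S A T L k ga al : R) :
  1 <= S -> 1 <= A -> 1 <= T -> 1 / 2 <= L -> 0 < ga <= T -> 0 < k ->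
  200 * L ^+ 2 * (S ^+ 2 * A * T ^+ 4 / ga ^+ 2) <= k ->
  al = ga / (2 * T ^+ 2) ->
  T * (T * (al / 2) + T * S * A * (S * ((8 * L / al + 19 * L + 28 * L ^+ 2) / k)))
    <= ga.
Proof.
move=> S1 A1 T1 hL /andP[g0 gT] k0 hk ->.
have T0 : T != 0 by rewrite gt_eqF //; lra.
have g0' : ga != 0 by rewrite gt_eqF.
have k0' : k != 0 by rewrite gt_eqF.
pose U := L ^+ 2 * S ^+ 2 * A.
have U0 : 0 <= U by rewrite !mulr_ge0 ?sqr_ge0 //; lra.
have LU : L * S ^+ 2 * A <= 2 * U.
  rewrite /U (_ : 2 * _ = (2 * L) * (L * S ^+ 2 * A)); last by ring.
  by rewrite ler_peMl ?mulr_ge0 ?sqr_ge0 //; lra.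
have hk' : 200 * U * T ^+ 4 <= k * ga ^+ 2.
  move: hk; rewrite (_ : 200 * _ * _ = 200 * U * T ^+ 4 / ga ^+ 2); last by rewrite /U; field.
  by rewrite ler_pdivrMr // exprn_gt0.
have -> : T * (T * (ga / (2 * T ^+ 2) / 2) +
    T * S * A * (S * ((8 * L / (ga / (2 * T ^+ 2)) + 19 * L + 28 * L ^+ 2) / k))) =
  ga / 4 + (16 * T ^+ 4 * (L * S ^+ 2 * A) / ga +
    T ^+ 2 * (19 * (L * S ^+ 2 * A) + 28 * U)) / k.
  by rewrite /U; field; rewrite T0 g0' k0'.
have e1 : 16 * T ^+ 4 * (L * S ^+ 2 * A) / ga <= 32 / 200 * (k * ga).
  rewrite ler_pdivrMr //.
  have : 16 * T ^+ 4 * (L * S ^+ 2 * A) <= 16 * T ^+ 4 * (2 * U).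
    by apply: ler_wpM2l => //; rewrite mulr_ge0 // exprn_ge0 //; lra.
  by move: hk'; rewrite expr2; lra.
have e2 : T ^+ 2 * (19 * (L * S ^+ 2 * A) + 28 * U) <= 66 / 200 * (k * ga).
  have : T ^+ 2 * (19 * (L * S ^+ 2 * A) + 28 * U) <= T ^+ 2 * (66 * U).
    by apply: ler_wpM2l; [exact: sqr_ge0|lra].
  move=> h; apply: le_trans h _.
  rewrite -(@ler_pM2r _ (T ^+ 2)); last by rewrite exprn_gt0 //; lra.
  have : k * ga * ga <= k * ga * T ^+ 2.
    apply: ler_wpM2l; first by rewrite mulr_ge0 // ltW.
    by apply: le_trans gT _; rewrite expr2 ler_peMr //; lra.
  move: hk'; rewrite (_ : T ^+ 4 = T ^+ 2 * T ^+ 2) -?exprD // [ga ^+ 2]expr2; lra.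
suff : (16 * T ^+ 4 * (L * S ^+ 2 * A) / ga +
    T ^+ 2 * (19 * (L * S ^+ 2 * A) + 28 * U)) / k <= 98 / 200 * ga by lra.
by rewrite ler_pdivrMr //; lra.
Qed.

(** Only an inequality, since the empirical row of an unvisited pair is zero. *)
Lemma sum_P_hat (R : realType) (S A : finType) (T : nat)
  (y : nat -> trajectory S A T) (k : nat) (t : 'I_T) (s : S) (a : A) :
  \sum_s' P_hat y k t s a s' <= 1 :> R.
Proof.
rewrite /P_hat -mulr_suml -natr_sum sum_transitions.
by rewrite ler_pdivrMr ?visits1_gt0 // mul1r ler_nat leq_maxl.
Qed.

Lemma base_policy_cost (R : realType) (S A : finType) (T K K0 k : nat) (delta : R)
  (s1 : S) (d : stagefun R S A T) (P : transition_kernel R S A T)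
  (pi0 : policy R S A T) (y : nat -> trajectory S A T) (ga : R) :
  let L := @logfactor R S A T K delta in
  is_kernel P -> is_policy pi0 -> ~ unreliable K K0 delta s1 P pi0 y ->
  (K0 < k)%N -> (0 < K0)%N -> (0 < #|A|)%N -> (0 < T)%N -> 1 / 2 <= L ->
  0 < ga <= T%:R ->
  200 * L ^+ 2 * (#|S|%:R ^+ 2 * #|A|%:R * T%:R ^+ 4 / ga ^+ 2) <= K0%:R ->
  value s1 (d_bar K delta d y k) pi0 P <= value s1 d pi0 P + ga.
Proof.
move=> L hP hpi hy K0k K00 A0 T0 hL hga hK0.
pose q t s a := occupancy s1 pi0 P t s a.
pose al := ga / (2 * T%:R ^+ 2).
pose C := (8 * L / al + 19 * L + 28 * L ^+ 2) / K0%:R.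
have k0 : 0 < K0%:R :> R by rewrite ltr0n.
have al0 : 0 < al.
  by case/andP: hga => g0 _; rewrite divr_gt0 // mulr_gt0 // exprn_gt0 // ltr0n.
(* In the sum over [s'] the factors [P_hat] add up to at most 1, so the first-order part does not
   acquire a factor |S|. *)
have hq t s a : q t s a * beta K delta y k t s a <= al / 2 * q t s a + #|S|%:R * C.
  have q0 : 0 <= q t s a by exact: occupancy_ge0.
  have N1 : 1 <= visits1 y k t s a :> R by rewrite /visits1 ler1n leq_max orbT.
  have hN : K0%:R * q t s a / 2 - L <= visits1 y k t s a.
    apply: (@le_trans _ _ (visits y K0.+1 t s a)%:R).
      by rewrite leNgt; apply/negP => h; apply: hy; right; exists t, s, a.
    by rewrite /visits1 ler_nat leq_max leq_visits.
  rewrite /beta mulr_sumr; apply: (@le_trans _ _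
      (\sum_s' (al / 2 * q t s a * P_hat y k t s a s' + C))).
    by apply: ler_sum => s' _; apply: weighted_width => //; exact: P_hat_bounds.
  rewrite big_split /= -mulr_sumr sumr_const -(mulr_natl C) lerD2r.
  rewrite -[leRHS]mulr1; apply: ler_wpM2l; last exact: sum_P_hat.
  by rewrite mulr_ge0 //; lra.
rewrite !value_occupancy.
have -> : \sum_(t < T) \sum_s \sum_a q t s a * d_bar K delta d y k t s a =
    \sum_(t < T) \sum_s \sum_a q t s a * d t s a +
    T%:R * \sum_(t < T) \sum_s \sum_a q t s a * beta K delta y k t s a.
  rewrite mulr_sumr -big_split /=; apply: eq_bigr => t _.
  rewrite mulr_sumr -big_split /=; apply: eq_bigr => s _.
  rewrite mulr_sumr -big_split /=; apply: eq_bigr => a _.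
  by rewrite /d_bar mulrDr mulrCA.
rewrite lerD2l.
have S1 : 1 <= #|S|%:R :> R by rewrite ler1n; apply/card_gt0P; exists s1.
have A1 : 1 <= #|A|%:R :> R by rewrite ler1n.
have T1 : 1 <= T%:R :> R by rewrite ler1n.
apply: le_trans (width_budget S1 A1 T1 hL hga k0 hK0 (erefl al)).
apply: ler_wpM2l => //.
apply: (@le_trans _ _ (\sum_(t < T) \sum_s \sum_a
    (al / 2 * q t s a + #|S|%:R * C))).
  by do 3 (apply: ler_sum => ? _); exact: hq.
(* The occupancies of a stage sum to 1, so only the constant is multiplied by the number of
   pairs. *)
rewrite (eq_bigr (fun=> al / 2 + #|S|%:R * (#|A|%:R * (#|S|%:R * C)))); last first.
  move=> t _; have e : al / 2 = \sum_s \sum_a al / 2 * q t s a.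
    under eq_bigr do rewrite -mulr_sumr.
    by rewrite -mulr_sumr sum_occupancy // mulr1.
  have sumc (I : finType) (x : R) : #|I|%:R * x = \sum_(i : I) x.
    by rewrite sumr_const mulr_natl.
  rewrite [X in _ = X + _]e (sumc S (_ * (_ * _))) -big_split /=; apply: eq_bigr => s _.
  by rewrite (sumc A) -big_split.
rewrite sumr_const card_ord -[leLHS]mulr_natl mulrDr lerD2l.
by rewrite !mulrA.
Qed.

(** * Existence of optimal pairs *)

Lemma closed_forall (X : topologicalType) (I : Type) (Q : I -> X -> Prop) :
  (forall i, closed [set z | Q i z]) -> closed [set z | forall i, Q i z].
Proof.
move=> h; rewrite (_ : mkset _ = \bigcap_(i in [set: I]) [set z | Q i z]).
  exact: closed_bigI.
by apply/seteqP; split=> z hz i; [move=> _; exact: hz|exact: hz].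
Qed.

Lemma closed_and (X : topologicalType) (Q1 Q2 : X -> Prop) :
  closed [set z | Q1 z] -> closed [set z | Q2 z] -> closed [set z | Q1 z /\ Q2 z].
Proof. exact: closedI. Qed.

Lemma closed_ler (R : realType) (X : topologicalType) (f : X -> R) (c : R) :
  continuous f -> closed [set z | f z <= c].
Proof.
move=> cf; apply: (@preimage_closed _ _ f [set x | x <= c]); last exact: closed_le.
by move=> z _; exact: cf.
Qed.

Lemma closed_ger (R : realType) (X : topologicalType) (f : X -> R) (c : R) :
  continuous f -> closed [set z | c <= f z].
Proof.
move=> cf; apply: (@preimage_closed _ _ f [set x | c <= x]); last exact: closed_ge.
by move=> z _; exact: cf.
Qed.

Lemma closed_eqr (R : realType) (X : topologicalType) (f : X -> R) (c : R) :
  continuous f -> closed [set z | f z = c].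
Proof.
move=> cf; apply: (@preimage_closed _ _ f [set x | x = c]); last exact: closed_eq.
by move=> z _; exact: cf.
Qed.

Lemma continuous_sumr (R : realType) (X : topologicalType) (I : finType)
  (f : I -> X -> R) :
  (forall i, continuous (f i)) -> continuous (fun z => \sum_i f i z).
Proof. by move=> cf; apply: continuous_big => //; exact: add_continuous. Qed.

Lemma continuous_prodr (R : realType) (X : topologicalType) (I : finType)
  (f : I -> X -> R) :
  (forall i, continuous (f i)) -> continuous (fun z => \prod_i f i z).
Proof. by move=> cf; apply: continuous_big => //; exact: mul_continuous. Qed.

Lemma continuous_mulr (R : realType) (X : topologicalType) (f g : X -> R) :
  continuous f -> continuous g -> continuous (fun z => f z * g z).
Proof. by move=> cf cg z; apply: continuousM; [exact: cf|exact: cg]. Qed.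

Lemma continuous_value (R : realType) (X : topologicalType) (S A : finType)
  (T : nat) (s1 : S) (r : stagefun R S A T) (pi : X -> policy R S A T)
  (P : X -> transition_kernel R S A T) :
  (forall t s a, continuous (fun z => pi z t s a)) ->
  (forall t s a s', continuous (fun z => P z t s a s')) ->
  continuous (fun z => value s1 r (pi z) (P z)).
Proof.
move=> cpi cP; apply: continuous_sumr => x.
apply: continuous_mulr; last by move=> z; exact: cvg_cst.
apply: continuous_mulr; first by move=> z; exact: cvg_cst.
by apply: continuous_prodr => t; apply: continuous_mulr.
Qed.

(** Policy and kernel are packed into one real row vector: the feasible set becomes a closed subset
    of a cube and the objective a polynomial, so the extreme value theorem applies. The given
    feasible pair makes the set nonempty. *)
Lemma balde_solution_exists (R : realType) (S A : finType) (T K : nat) (delta : R)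
  (s1 : S) (l d : stagefun R S A T) (b_base : R) (y : nat -> trajectory S A T)
  (k : nat) (b : R) (pi0 : policy R S A T) (P0 : transition_kernel R S A T) :
  feasible K delta s1 d y k b pi0 P0 ->
  exists pi P', balde_solution K delta s1 l d b_base y k b pi P'.
Proof.
move=> feas0.
pose I : finType := (('I_T * S * A) + ('I_T * S * A * S))%type.
pose pol (z : 'rV[R]_#|I|) : policy R S A T :=
  fun t s a => z ord0 (enum_rank (inl (t, s, a) : I)).
pose ker (z : 'rV[R]_#|I|) : transition_kernel R S A T :=
  fun t s a s' => z ord0 (enum_rank (inr (t, s, a, s') : I)).
pose code (pi : policy R S A T) (P : transition_kernel R S A T) : 'rV[R]_#|I| :=
  \row_i match enum_val i with
         | inl (t, s, a) => pi t s a
         | inr (t, s, a, s') => P t s a s' end.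
have polK pi P : pol (code pi P) = pi.
  by apply/funext => t; apply/funext => s; apply/funext => a;
    rewrite /pol mxE enum_rankK.
have kerK pi P : ker (code pi P) = P.
  by apply/funext => t; apply/funext => s; apply/funext => a; apply/funext => s';
    rewrite /ker mxE enum_rankK.
have cpol t s a : continuous (fun z => pol z t s a) by exact: coord_continuous.
have cker t s a s' : continuous (fun z => ker z t s a s') by exact: coord_continuous.
pose C := [set z | feasible K delta s1 d y k b (pol z) (ker z)].
have clC : closed C.
  have -> : C = [set z | is_policy (pol z) /\
      ((is_kernel (ker z) /\ forall t s a s',
         `|ker z t s a s' - P_hat y k t s a s'| <= beta3 K delta y k t s a s') /\
       value s1 (d_bar K delta d y k) (pol z) (ker z) <= b)].
    by apply/seteqP; split=> z; [case=> *; split|case=> ? [? ?]; split].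
  apply: closed_and.
    apply: closed_forall => t; apply: closed_forall => s; apply: closed_and.
      by apply: closed_forall => a; apply: closed_ger.
    by apply: closed_eqr; exact: continuous_sumr.
  apply: closed_and; last by apply: closed_ler; exact: continuous_value.
  apply: closed_and.
    apply: closed_forall => t; apply: closed_forall => s; apply: closed_forall => a.
    apply: closed_and; first by apply: closed_forall => s'; apply: closed_ger.
    by apply: closed_eqr; exact: continuous_sumr.
  apply: closed_forall => t; apply: closed_forall => s; apply: closed_forall => a.
  apply: closed_forall => s'; apply: closed_ler => z.
  exact: (cvg_norm (cvgB (cker t s a s' z) (cvg_cst _))).
have coC : compact C.
  have coB := @rV_compact R #|I| (fun=> `[0, 1]%classic)
    (fun=> segment_compact (R := R) (a := 0) (b := 1)).
  refine (subclosed_compact clC coB _) => z [hpi [hP _] _] i.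
  rewrite /= in_itv /= -(enum_valK i).
    case: (enum_val i) => [[[t s] a]|[[[t s] a] s']].
      have [h0 h1] := hpi t s; rewrite -/(pol z t s a) h0 -h1 /=.
      by rewrite (bigD1 a) //= lerDl; apply: sumr_ge0.
    have [h0 h1] := hP t s a; rewrite -/(ker z t s a s') h0 -h1 /=.
    by rewrite (bigD1 s') //= lerDl; apply: sumr_ge0.
have C0 : C !=set0 by exists (code pi0 P0); rewrite /C /= polK kerK.
pose v z := value s1 (l_bar K delta l b_base y k b) (pol z) (ker z).
have cv : {within C, continuous v}.
  by apply: continuous_subspaceT; exact: continuous_value.
have [z] := compact_EVT_min C0 coC cv.
rewrite inE => Cz hz; exists (pol z), (ker z); split=> // pi2 P2 feas2.
have := hz (code pi2 P2); rewrite /v polK kerK; apply.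
by rewrite inE /C /= polK kerK.
Qed.

(** * Budget satisfaction *)

(** Through [P_hat], the rows of [P] and [P'] are at l1 distance at most [2 * beta], which is the
    distance that the bonus covers in [value_simulation]. *)
Lemma value_le_budget (R : realType) (S A : finType) (T K : nat) (delta : R)
  (s1 : S) (d : stagefun R S A T) (P P' : transition_kernel R S A T)
  (y : nat -> trajectory S A T) (k : nat) (b : R) (pi : policy R S A T) :
  unit_valued d -> confidence_set K delta y k P ->
  feasible K delta s1 d y k b pi P' -> value s1 d pi P <= b.
Proof.
move=> hd [hP cP] [hpi [hP' cP'] hb]; apply: le_trans hb.
apply: value_simulation => // t s a; rewrite /beta mulr_sumr.
apply: ler_sum => s' _; have := cP t s a s'; have := cP' t s a s'.
rewrite (distrC (P' _ _ _ _)) => h1 h2.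
by have := ler_distD (P_hat y k t s a s') (P t s a s') (P' t s a s'); lra.
Qed.

Lemma measurable_value (R : realType) (disp : measure_display)
  (Omega : measurableType disp) (S A : finType) (T : nat) (D : set Omega)
  (s1 : S) (r : stagefun R S A T) (pi : Omega -> policy R S A T)
  (P : transition_kernel R S A T) :
  (forall t s a, measurable_fun D (fun w => pi w t s a)) ->
  measurable_fun D (fun w => value s1 r (pi w) P).
Proof.
move=> hpi; apply: measurable_sum => x; apply: measurable_funM => //.
exact: measurable_traj_prob.
Qed.

Lemma measurable_wrt_fun (R : realType) (disp : measure_display)
  (Omega : measurableType disp) (G : set_system Omega) (f : Omega -> R) :
  G `<=` measurable -> measurable_wrt G f -> measurable_fun [set: Omega] f.
Proof. by move=> Gm Gf _ Y mY; apply/Gm/Gf; exists Y. Qed.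

Unset Implicit Arguments.

Theorem theorem2 (R : realType) :
  exists (c : R) (p : nat),
  forall (S A : finType) (T K K0 : nat) (s1 : S)
    (l d : stagefun R S A T) (P : transition_kernel R S A T)
    (pi_base : policy R S A T) (b_base B0 delta : R),
  unit_valued l -> unit_valued d -> is_kernel P -> is_policy pi_base ->
  value s1 d pi_base P = b_base -> b_base < B0 -> B0 <= T%:R ->
  0 < delta < 1 ->
  c * logfactor (S := S) (A := A) (T := T) K delta ^+ p
    * (#|S|%:R ^+ 2 * #|A|%:R * T%:R ^+ 4 / (B0 - b_base) ^+ 2) <= K0%:R ->
  forall (disp : measure_display) (Omega : measurableType disp)
    (Pr : probability Omega R) (F : nat -> set_system Omega)
    (X : nat -> Omega -> trajectory S A T)
    (b : nat -> Omega -> R) (pi : nat -> Omega -> policy R S A T),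
  interaction Pr K s1 P F X b pi ->
  (forall k w, (0 < k <= K)%N ->
     B0 <= b k w <= T%:R /\ ((k <= K0)%N -> b k w = B0)) ->
  (forall k w, (0 < k <= K)%N ->
     balde_policy K delta s1 l d b_base pi_base K0 (X ^~ w) k (b k w) (pi k w)) ->
  ((1 - 3 * delta)%:E <=
     Pr [set w | forall k, (0 < k <= K)%N -> (value s1 d (pi k w) P <= b k w)%R])%E.
Proof.
(* The constant and the power of the logarithm are those of [width_budget]. *)
exists 200, 2%N => S A T K K0 s1 l d P pi_base b_base B0 delta hl hd hP hpib hV hgap.
move=> hB0 /andP[delta0 delta1] hK0 disp Omega Pr F X b pi hint hb halg.
have [[_ Fm _] hint'] := hint.
set G := [set w | _].
have mG : measurable G.
  rewrite (_ : G = \bigcap_(k in [set k | (0 < k <= K)%N])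
      ([set: Omega] `&` [set w | value s1 d (pi k w) P <= b k w])); last first.
    by apply/seteqP; split=> w hw k kK; [split=> //; exact: hw|have [] := hw k kK].
  apply: bigcap_measurableType => k kK; have [mb mpi _ _] := hint' k kK.
  apply: measurable_fun_le => //; last exact: measurable_wrt_fun (Fm k) mb.
  by apply: measurable_value => t s a; exact: measurable_wrt_fun (Fm k) (mpi t s a).
have hbase k w : (0 < k <= K)%N -> (k <= K0)%N -> value s1 d (pi k w) P <= b k w.
  move=> kK kK0; have [_ -> // _] := halg k w kK.
  by rewrite hV; have [/andP[h _] _] := hb k w kK; rewrite ltW // (lt_le_trans hgap).
(* If all episodes belong to the warm-up, the event is certain. Otherwise [K0 < K], which below
   yields |S|^3 <= exp L. *)
have [KK0|K0K] := leqP K K0.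
  rewrite (_ : G = [set: Omega]).
    by rewrite probability_setT lee_fin gerBl mulr_ge0 // ltW.
  apply/seteqP; split=> // w _ k kK; apply: hbase => //.
  by case/andP: kK => _ kK; exact: leq_trans KK0.
have T0 : (0 < T)%N.
  (* At horizon 0 the baseline value is 0, which contradicts [b_base < B0 <= T]. *)
  rewrite lt0n; apply/eqP => T0.
  move: d pi_base P hV hB0 {hl hd hP hpib hbase G mG hint hint' halg hb hK0}.
  move: l X pi; rewrite T0 => _ _ _ d pi_base P; rewrite value_T0 => e1 e2.
  by move: hgap; rewrite -e1 ltNge e2.
have A0 : (0 < #|A|)%N.
  rewrite lt0n; apply/eqP => /card0_eq A0.
  have [_] := hpib (Ordinal T0) s1.
  rewrite big_pred0 => [/eqP|a]; first by rewrite eq_sym oner_eq0.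
  by have := A0 a; rewrite !inE.
pose ga := B0 - b_base.
have b0 : 0 <= b_base by rewrite -hV; have /andP[] := value_bounds s1 hpib hP hd.
have hga : 0 < ga <= T%:R by apply/andP; split; rewrite /ga; lra.
have S1 : 1 <= #|S|%:R :> R by rewrite ler1n; apply/card_gt0P; exists s1.
have A1 : 1 <= #|A|%:R :> R by rewrite ler1n.
have T1 : 1 <= T%:R :> R by rewrite ler1n.
have K1 : 1 <= K%:R :> R by rewrite ler1n (leq_trans _ K0K).
set L := logfactor K delta in hK0.
pose M : R := 2 * #|S|%:R * #|A|%:R * T%:R * K%:R.
have SK : #|S|%:R * K%:R <= M.
  rewrite /M [leRHS](_ : _ = #|S|%:R * K%:R * (2 * #|A|%:R * T%:R)); last by ring.
  rewrite ler_peMr ?mulr_ge0 //.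
  by apply: (@le_trans _ _ (2 * #|A|%:R)); [lra|rewrite ler_peMr ?mulr_ge0].
have M2 : 2 <= M.
  by rewrite /M -!mulrA ler_peMr // !mulr_ege1.
have Md : M <= M / delta by rewrite ler_pdivlMr // ler_piMr //; lra.
have M0 : 0 < M / delta by rewrite divr_gt0 //; lra.
have eL : expR L = M / delta by rewrite /L /logfactor lnK ?posrE.
have hL : 1 / 2 <= L.
  apply: le_trans (ln2_ge_half R) _; rewrite /L /logfactor ler_ln ?posrE //.
  exact: le_trans Md.
have hexp : expR (- L) * M = delta.
  by rewrite expRN eL invf_div divfK // gt_eqF //; lra.
(* 50 is 200 / 4, from [1 / 2 <= L]; the factor T^4 / ga^2 is at least 1 because [ga <= T]. *)
have K0S : 50 * #|S|%:R ^+ 2 <= K0%:R :> R.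
  apply: le_trans hK0; have L2 : 1 / 4 <= L ^+ 2 by rewrite expr2; nra.
  have hT : 1 <= T%:R ^+ 4 / ga ^+ 2.
    case/andP: hga => g0 gT; rewrite ler_pdivlMr ?exprn_gt0 // mul1r.
    rewrite (_ : 4%N = (2 * 2)%N) // exprM ler_pXn2r ?nnegrE ?exprn_ge0 //.
      by apply: le_trans gT _; rewrite expr2 ler_peMr.
    exact: ltW.
  have -> : #|S|%:R ^+ 2 * #|A|%:R * T%:R ^+ 4 / (B0 - b_base) ^+ 2 =
      #|S|%:R ^+ 2 * (#|A|%:R * (T%:R ^+ 4 / ga ^+ 2)) by rewrite !mulrA.
  apply: ler_pM; [by []|exact: sqr_ge0|lra|].
  by rewrite ler_peMr ?sqr_ge0 // mulr_ege1.
have K00 : (0 < K0)%N.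
  rewrite -(ltr_nat R); apply: lt_le_trans K0S.
  by rewrite mulr_gt0 // exprn_gt0 // (lt_le_trans ltr01).
have hS : #|S|%:R ^+ 3 <= expR L.
  rewrite eL; apply: le_trans Md; apply: le_trans SK.
  rewrite exprS ler_wpM2l //; apply: le_trans (_ : K0%:R <= _).
    by apply: le_trans K0S; rewrite ler_peMl ?sqr_ge0 //; lra.
  by rewrite ler_nat ltnW.
have [mU leU] := unreliable_unlikely hint hP hpib
  (fun k w kK => let: And3 h _ _ := halg k w kK in h)
  (fun k w kK => let: And3 _ h _ := halg k w kK in h)
  (ltnW K0K) (leq_ltn_trans (leq0n K0) K0K) delta0 hL hexp hS.
set U := [set w | _] in mU leU.
apply: (@le_trans _ _ (Pr (~` U))); last first.
  apply: le_measure; rewrite ?inE //; first exact: measurableC.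
  move=> w nU k kK; have [kK0|K0k] := leqP k K0; first exact: hbase.
  have cP : confidence_set K delta (X ^~ w) k P.
    split=> // t s a s'; rewrite leNgt; apply/negP => h; apply: nU; left.
    by exists k, t, s, a, s'.
  have [/andP[hbk _] _] := hb k w kK.
  have [_ _ hsol] := halg k w kK.
  have [|P' [feas _]] := hsol K0k; last exact: value_le_budget feas.
  apply: (@balde_solution_exists _ _ _ _ _ _ _ _ _ _ _ _ _ pi_base P).
  split=> //; apply: le_trans hbk.
  have nU' : ~ unreliable K K0 delta s1 P pi_base (X ^~ w) := nU.
  apply: le_trans (base_policy_cost d hP hpib nU' K0k K00 A0 T0 hL hga hK0) _.
  by rewrite hV /ga; lra.
rewrite probability_setC //; apply: (@le_trans _ _ (1 - (2 * delta)%:E)%E).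
  by rewrite -EFinB lee_fin; lra.
exact: leeB.
Qed.
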